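(* Let $M \subseteq H^2(\mathbb{D},\mathbb{C}^n)$ be a closed subspace that is nearly $S^*$-invariant with finite defect $m$ and with $m$-dimensional defect space $D$ orthogonal to $M$. Let $\{e_1,\dots,e_m\}$ be any orthonormal basis of $D$. Then: 1. In the case where there are functions in $M$ that do not vanish at $0$, let $W = M \ominus (M\cap zH^2(\mathbb{D},\mathbb{C}^n))$, $r = \dim W$, and let $F_0$ be the $n\times r$ matrix whose columns form an orthonormal basis of $W$. Then there is a closed $S^*$-invariant subspace $K \subseteq H^2(\mathbb{D},\mathbb{C}^{r+m})$ such that $$M = \Big\{F : F(z) = F_0(z)k_0(z) + z\sum_{j=1}^m k_j(z)e_j(z) : (k_0,\dots,k_m) \in K\Big\},$$ where $k_0 \in H^2(\mathbb{D},\mathbb{C}^r)$ and $k_1,\dots,k_m \in H^2$. Furthermore, for $F$ corresponding to $(k_0,\dots,k_m)\in K$, $\|F\|^2 = \sum_{j=0}^m \|k_j\|^2$. 2. In the case where all functions in $M$ vanish at $0$, there is a closed $S^*$-invariant subspace $K \subseteq H^2(\mathbb{D},\mathbb{C}^m)$ such that $$M = \Big\{F : F(z) = z\sum_{j=1}^m k_j(z)e_j(z) : (k_1,\dots,k_m)\in K\Big\},$$ and, for $F$ corresponding to $(k_1,\dots,k_m)\in K$, $\|F\|^2 = \sum_{j=1}^m \|k_j\|^2$. Conversely, if a closed subspace $M \subseteq H^2(\mathbb{D},\mathbb{C}^n)$ has a representation as in 1 or 2 (for some $m$-dimensional subspace $D$ orthogonal to $M$ with orthonormal basis $e_1,\dots,e_m$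 and some closed $S^*$-invariant subspace $K$ as there), then $M$ is nearly $S^*$-invariant with defect $m$.
   Context: $H^2(\mathbb{D},\mathbb{C}^n)$ is the Hilbert space of column vectors of length $n$ with entries in the Hardy space $H^2$ of the unit disc $\mathbb{D}$. The backward shift is $S^*F(z) = (F(z)-F(0))/z$ (entrywise). A closed subspace $M$ is nearly $S^*$-invariant with defect $m$ if there is an $m$-dimensional subspace $D$ (which may be taken orthogonal to $M$) such that $S^*f \in M \oplus D$ whenever $f \in M$ and $f(0)=0$. The space $H^2(\mathbb{D},\mathbb{C}^r)\times (H^2)^m$ is identified with $H^2(\mathbb{D},\mathbb{C}^{r+m})$. *)

(* Defs.v *)
From HB Require Import structures.
From mathcomp Require Import all_boot all_order all_algebra.
From mathcomp Require Import all_classical all_reals all_analysis.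
From mathcomp Require Import complex.

Set Implicit Arguments.
Unset Strict Implicit.
Unset Printing Implicit Defensive.

Import Order.TTheory GRing.Theory Num.Theory numFieldNormedType.Exports.

Local Open Scope classical_set_scope.
Local Open Scope ring_scope.

(* R[i], declared as a numClosedFieldType so that it receives the topology that
   MathComp-Analysis puts on every numClosedFieldType. *)
Definition C (R : realType) : numClosedFieldType := R[i].

(* Functions live on the open unit disc itself, so that Leibniz equality of
   functions is equality on the disc. *)
Definition disc (R : realType) := {z : C R | `|z| < 1}.

Lemma disc0_subproof (R : realType) : `|0 : C R| < 1.
Proof. by rewrite normr0 ltr01. Qed.

Definition disc0 (R : realType) : disc R := exist _ 0 (disc0_subproof R).

Notation vfun R n := (disc R -> 'cV[C R]_n).

Section ScalarHardySpace.
Variable R : realType.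
Implicit Types (a : nat -> C R) (f g : disc R -> C R).

Definition has_taylor f a :=
  forall z : disc R, series (fun k => a k * val z ^+ k) @ \oo --> f z.

(* Normc.normc is the R-valued modulus; `|_| on C R takes its values in C R. *)
Definition square_summable a :=
  cvgn (series (fun k => Normc.normc (a k) ^+ 2) : nat -> R).

Definition hardy : set (disc R -> C R) :=
  [set f | exists2 a, has_taylor f a & square_summable a].

(* The Taylor coefficients are unique when they exist; they are all 0 by
   convention for a function that is not analytic on the disc. *)
Definition taylor f : nat -> C R := xget (fun=> 0) (has_taylor f).

Definition hardy_inner f g : C R :=
  limn (series (fun k => taylor f k * (taylor g k)^*)).

Definition hardy_normsq f : R :=
  limn (series (fun k => Normc.normc (taylor f k) ^+ 2)).

(* At 0 the quotient (f z - f 0) / z is extended by its limit f'(0), which is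
   the Taylor coefficient of index 1. *)
Definition hardy_backshift f : disc R -> C R := fun z =>
  if val z == 0 then taylor f 1%N else (f z - f (disc0 R)) / val z.

End ScalarHardySpace.

Arguments hardy : clear implicits.

Section VectorHardySpace.
Variables (R : realType) (n : nat).
Implicit Types (F G : vfun R n) (M N D : set (vfun R n)).

Definition entry F (i : 'I_n) : disc R -> C R := fun z => F z i 0.

Definition H2 : set (vfun R n) := [set F | forall i, hardy R (entry F i)].

Definition inner F G : C R := \sum_i hardy_inner (entry F i) (entry G i).

Definition normsq F : R := \sum_i hardy_normsq (entry F i).

Definition backshift F : vfun R n :=
  fun z => \col_i hardy_backshift (entry F i) z.

Definition linear_subspace M :=
  M 0 /\ forall (c : C R) F G, M F -> M G -> M (c *: F + G).

(* Closed in the norm of H2: since H2 is a metric space, closed means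
   sequentially closed. *)
Definition closed_subspace M :=
  [/\ M `<=` H2, linear_subspace M &
      forall (F_ : nat -> vfun R n) F, (forall k, M (F_ k)) -> H2 F ->
        normsq (F_ k - F) @[k --> \oo] --> (0 : R) -> M F].

Definition backshift_invariant M := forall F, M F -> M (backshift F).

Definition span m (b : 'I_m -> vfun R n) : set (vfun R n) :=
  [set F | exists c : 'I_m -> C R, F = \sum_i c i *: b i].

Definition lin_indep m (b : 'I_m -> vfun R n) :=
  forall c : 'I_m -> C R, \sum_i c i *: b i = 0 -> forall i, c i = 0.

Definition has_dim D m :=
  exists b : 'I_m -> vfun R n, lin_indep b /\ D = span b.

Definition orthogonal_sets M N := forall F G, M F -> N G -> inner F G = 0.

Definition orthonormal_basis m (e : 'I_m -> vfun R n) D :=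
  (forall i j, inner (e i) (e j) = (i == j)%:R) /\ D = span e.

Definition ominus M N : set (vfun R n) :=
  [set F | M F /\ forall G, N G -> inner F G = 0].

Definition setsum M N : set (vfun R n) :=
  [set F | exists G1 G2, [/\ M G1, N G2 & F = G1 + G2]].

Definition zH2 : set (vfun R n) :=
  [set F | exists2 G, H2 G & forall z, F z = val z *: G z].

Definition defect_space M m D :=
  [/\ D `<=` H2, has_dim D m, M `&` D = [set 0] &
      forall F, M F -> F (disc0 R) = 0 -> setsum M D (backshift F)].

Definition nearly_invariant M m :=
  closed_subspace M /\ exists D, defect_space M m D.

End VectorHardySpace.

Arguments H2 : clear implicits.
Arguments zH2 : clear implicits.

Section Representations.
Variables (R : realType) (n m : nat).

Definition columns r (F0 : disc R -> 'M[C R]_(n, r)) : 'I_r -> vfun R n :=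
  fun j z => col j (F0 z).

Definition repr_vanishing (e : 'I_m -> vfun R n) (k : vfun R m) : vfun R n :=
  fun z => val z *: \sum_j k z j 0 *: e j z.

(* An element of H2(C^(r+m)) is read as (k_0, k_1, ..., k_m), where k_0 consists
   of the first r entries and k_1, ..., k_m are the last m entries. *)
Definition head_part r (k : vfun R (r + m)) : vfun R r :=
  fun z => usubmx (k z).

Definition tail_part r (k : vfun R (r + m)) : vfun R m :=
  fun z => dsubmx (k z).

Definition repr_nonvanishing r (F0 : disc R -> 'M[C R]_(n, r))
    (e : 'I_m -> vfun R n) (k : vfun R (r + m)) : vfun R n :=
  fun z => F0 z *m head_part k z + repr_vanishing e (tail_part k) z.

End Representations.

(* Main.v *)
Require Import Defs.
From HB Require Import structures.
From mathcomp Require Import all_boot all_order all_algebra.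
From mathcomp Require Import all_classical all_reals all_analysis.
From mathcomp Require Import complex.
From mathcomp Require Import ring lra.

Set Implicit Arguments.
Unset Strict Implicit.
Unset Printing Implicit Defensive.

Import Order.TTheory GRing.Theory Num.Theory numFieldNormedType.Exports.

Local Open Scope classical_set_scope.
Local Open Scope ring_scope.

(** A function in H2 is handled through its sequence of Taylor coefficients, so
that H2 becomes the Hilbert space [ell2] of square-summable vector sequences,
the backward shift drops the first coefficient ([bshift]), and multiplication
by z prepends a zero ([fshift]).

Forward direction. Let P0 be the orthogonal projection of M onto the functions
of M vanishing at 0. Any F in M is F0 c + P0 F for a constant vector c, and near
invariance gives S* P0 F = G + sum_j d_j e_j with G in M. So
  F = F0 c + z sum_j d_j e_j + z G,   |F|^2 = |c|^2 + |d|^2 + |G|^2,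
and the step T : F |-> G can be repeated on G. With E = (F0, z e_1, ..., z e_m)
and k the power series of the vectors (c, d) read at the successive steps,
  F = (partial sum of E k) + z^N T^N F,   |F|^2 = |partial sum of k|^2 + |T^N F|^2.
At a point of the disc z^N T^N F tends to 0, which gives F = E k; then K is the
set of all these k, and T acts on K as the backward shift.

Everything else rests on T^N F --> 0 in norm ([iter_peel_to0]): this makes
F |-> k isometric, and hence K closed. It does not follow from T being a
contraction. On M, T differs from S* by an operator of finite rank, and the
defect I - T*T has finite rank too. The proof has two steps.
- For v = g - T T* g, consider the linear system x_(i+1) = T x_i + s_i v with
  scalar input s, whose output is the vector (c, d) read on x_i. An energy
  balance bounds the l2 norm of the output by a constant times that of the input
  ([state_bound]). The coefficients of T^N v are those of S*^N v minus such
  outputs, the input being a row of coefficients of S*^n E; hence the average of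
  |T^N v|^2 over N is bounded by averages of |S*^n v|^2 and |S*^n E|^2, which
  tend to 0 ([iter_peel_adj_defect_to0]).
- The vectors of M with T^N f --> 0 form a closed subspace, stable under T* and
  containing every f - T*T f. A vector orthogonal to it has all its data (c, d)
  equal to zero, so T acts on it isometrically and as S*: it is 0.

Converse. If F = F0 k_0 + z sum_j k_j e_j vanishes at 0, then so does k_0, since
a combination of the columns of F0 vanishing at 0 is orthogonal to itself.
Dividing by z gives S* F = (the function represented by S* k) + sum_j k_j(0) e_j,
in M + D ([nearly_invariant_of_representation]).

The case where M vanishes at 0 is the case r = 0, where W = 0. *)

(** * Complex sequences and series *)

Lemma sqrD_le (R : realFieldType) (a b : R) : (a + b) ^+ 2 <= 2 * a ^+ 2 + 2 * b ^+ 2.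
Proof. by have := sqr_ge0 (a - b); rewrite !expr2; lra. Qed.

Lemma mul_le_sqr (R : realFieldType) (a b : R) : a * b <= a ^+ 2 + b ^+ 2.
Proof. by have := sqr_ge0 (a - b); have := sqr_ge0 a; have := sqr_ge0 b; rewrite !expr2; lra. Qed.

Section ComplexModulus.
Variable R : realType.
Implicit Types (x y : C R).

Definition cmod x : R := Normc.normc x.
Definition cplx (a : R) : C R := real_complex R a.

Lemma norm_cmod x : `|x| = cplx (cmod x). Proof. by case: x. Qed.
Lemma cmod_ge0 x : 0 <= cmod x. Proof. by case: x => a b; rewrite /cmod /= sqrtr_ge0. Qed.
Lemma cplxM (a b : R) : cplx (a * b) = cplx a * cplx b. Proof. exact: rmorphM. Qed.
Lemma cplx_inj : injective cplx. Proof. exact: (@complexI R). Qed.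
Lemma cplx_sum I (r : seq I) (P : pred I) (F : I -> R) :
  cplx (\sum_(i <- r | P i) F i) = \sum_(i <- r | P i) cplx (F i).
Proof. exact: rmorph_sum. Qed.
Lemma cmod0 : cmod 0 = 0. Proof. exact: Normc.normc0. Qed.
Lemma cmod1 : cmod 1 = 1. Proof. exact: Normc.normc1. Qed.
Lemma cmodM x y : cmod (x * y) = cmod x * cmod y. Proof. exact: Normc.normcM. Qed.
Lemma cmodX x n : cmod (x ^+ n) = cmod x ^+ n.
Proof. by elim: n => [|n IH]; rewrite ?expr0 ?cmod1 // !exprS cmodM IH. Qed.
Lemma cmodN x : cmod (- x) = cmod x. Proof. exact: normcN. Qed.
Lemma cmodD x y : cmod (x + y) <= cmod x + cmod y. Proof. exact: le_normcD. Qed.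
Lemma cmod_eq0 x : cmod x = 0 -> x = 0. Proof. exact: Normc.eq0_normc. Qed.
Lemma cmod_conj x : cmod (x^*) = cmod x.
Proof. by apply: (@complexI R); have := norm_conjC x; rewrite !norm_cmod. Qed.
Lemma cmod_cplx (a : R) : cmod (cplx a) = `|a|.
Proof. by rewrite /cmod /cplx /= expr0n addr0 sqrtr_sqr. Qed.
Lemma cmod2 : cmod 2 = 2.
Proof. by rewrite (_ : 2 = cplx 2) ?cmod_cplx ?ger0_norm // /cplx rmorph_nat. Qed.
Lemma conj_cplx (a : R) : (cplx a)^* = cplx a.
Proof. by rewrite conj_Creal // complex_real. Qed.
Lemma cmod_sum I (r : seq I) (P : pred I) (F : I -> C R) :
  cmod (\sum_(i <- r | P i) F i) <= \sum_(i <- r | P i) cmod (F i).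
Proof.
elim/big_rec2: _ => [|i y1 y2 _ IH]; first by rewrite cmod0.
by apply: le_trans (cmodD _ _) _; rewrite lerD2l.
Qed.
Lemma cmodB x y : cmod (x - y) = cmod (y - x). Proof. by rewrite -cmodN opprB. Qed.
Lemma cmod_sqr x : cmod x ^+ 2 = complex.Re x ^+ 2 + complex.Im x ^+ 2.
Proof. by case: x => a b; rewrite /cmod /= sqr_sqrtr // addr_ge0 ?sqr_ge0. Qed.
Lemma cmod_mulC x : x * x^* = cplx (cmod x ^+ 2).
Proof. by rewrite -normCK norm_cmod /cplx rmorphXn. Qed.
Lemma Re_cmod x : `|complex.Re x| <= cmod x.
Proof. by case: x => a b; rewrite /cmod /= -sqrtr_sqr ler_wsqrtr // lerDl sqr_ge0. Qed.
Lemma Im_cmod x : `|complex.Im x| <= cmod x.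
Proof. by case: x => a b; rewrite /cmod /= -sqrtr_sqr ler_wsqrtr // lerDr sqr_ge0. Qed.
Lemma cmod_ReIm x : cmod x <= `|complex.Re x| + `|complex.Im x|.
Proof.
rewrite -(ler_pXn2r (ltn0Sn 1)) ?nnegrE ?cmod_ge0 ?addr_ge0 // cmod_sqr sqrrD !real_normK
  ?num_real //.
by rewrite lerD2r lerDl mulrn_wge0 // mulr_ge0.
Qed.

Lemma cvgC_cmod (u : nat -> C R) (l : C R) :
  u @ \oo --> l <-> cmod (u n - l) @[n --> \oo] --> (0 : R).
Proof.
split.
  move=> /cvgrPdist_lt H; apply/cvgrPdist_lt => e e0.
  have e0' : (0 : C R) < cplx e by rewrite /cplx ltcR.
  have {H} := H _ e0'; apply: filterS => n.
  by rewrite norm_cmod /cplx ltcR sub0r normrN ger0_norm ?cmod_ge0 // cmodB.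
move=> /cvgrPdist_lt H; apply/cvgrPdist_lt => e e0.
have e1 : e = cplx (complex.Re e) by move: e0; case: (e) => a b; rewrite ltcE /= =>
  /andP[/eqP -> _].
have e0' : 0 < complex.Re e by move: e0; rewrite e1 /cplx ltcR.
have {H} := H _ e0'; apply: filterS => n.
by rewrite norm_cmod e1 /cplx ltcR sub0r normrN ger0_norm ?cmod_ge0 // cmodB.
Qed.

Lemma cvg_to0_le (u v : nat -> R) : (forall n, 0 <= u n <= v n) ->
  v @ \oo --> 0 -> u @ \oo --> 0.
Proof.
move=> H readout; apply: (@squeeze_cvgr _ _ _ _ (fun=> 0) v) => //; last exact: cvg_cst.
by apply: nearW => n; exact: H.
Qed.

Lemma cvg0D (u v : nat -> R) : u @ \oo --> 0 -> v @ \oo --> 0 ->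
  (u n + v n) @[n --> \oo] --> (0 : R).
Proof. by move=> cu readout; rewrite -[0]addr0; exact: cvgD. Qed.

Lemma eq_cvgC (u v : nat -> C R) (l : C R) : u =1 v -> u @ \oo --> l -> v @ \oo --> l.
Proof. by move=> /funext ->. Qed.

Lemma cvgCB (u v : nat -> C R) (k l : C R) : u @ \oo --> k -> v @ \oo --> l ->
  (u n - v n) @[n --> \oo] --> k - l.
Proof. exact: cvgB. Qed.

Lemma cvgCD (u v : nat -> C R) (k l : C R) : u @ \oo --> k -> v @ \oo --> l ->
  (u n + v n) @[n --> \oo] --> k + l.
Proof. exact: cvgD. Qed.

Lemma cvgCZ (c : C R) (u : nat -> C R) (l : C R) : u @ \oo --> l ->
  (c * u n) @[n --> \oo] --> c * l.
Proof. by move=> ul; apply: cvgM; [exact: cvg_cst|exact: ul]. Qed.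

Lemma cvgC_Re (u : nat -> C R) (l : C R) : u @ \oo --> l ->
  complex.Re (u n) @[n --> \oo] --> complex.Re l.
Proof.
move/cvgC_cmod => H; apply/subr_cvg0/norm_cvg0P.
apply: (@cvg_to0_le _ (fun n => cmod (u n - l))) => // n; rewrite normr_ge0 /=.
by rewrite -(raddfB (@complex.Re R)); exact: Re_cmod.
Qed.

Lemma cvgC_ReIm (u : nat -> C R) (a b : R) :
  complex.Re (u n) @[n --> \oo] --> a -> complex.Im (u n) @[n --> \oo] --> b ->
    u @ \oo --> (Complex a b : C R).
Proof.
move=> Ha Hb; apply/cvgC_cmod.
have Ha' : `|complex.Re (u n) - a| @[n --> \oo] --> (0:R) by apply/norm_cvg0P/subr_cvg0.
have Hb' : `|complex.Im (u n) - b| @[n --> \oo] --> (0:R) by apply/norm_cvg0P/subr_cvg0.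
have Hab := cvg0D Ha' Hb'.
apply: (cvg_to0_le _ Hab) => n; rewrite cmod_ge0 /=.
by apply: le_trans (cmod_ReIm _) _; case: (u n) => c d.
Qed.

Lemma cvgC_conj (u : nat -> C R) (l : C R) : u @ \oo --> l -> (u n)^* @[n --> \oo] --> l^*.
Proof.
move=> /cvgC_cmod H; apply/cvgC_cmod; apply: cvg_trans H; apply: near_eq_cvg.
by apply: nearW => n; rewrite -rmorphB cmod_conj.
Qed.

Lemma cvgC_cplx (u : nat -> R) (l : R) : u @ \oo --> l -> cplx (u n) @[n --> \oo] --> cplx l.
Proof.
move=> H; apply: (@cvgC_ReIm (fun n => cplx (u n)) l 0) => //=; exact: cvg_cst.
Qed.

Lemma cvgC_unique (u : nat -> C R) (a b : C R) : u @ \oo --> a -> u @ \oo --> b -> a = b.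
Proof. by move=> Ha Hb; apply: (cvg_unique _ Ha Hb); apply: norm_hausdorff. Qed.

Lemma cvgC_lim (u : nat -> C R) (a : C R) : u @ \oo --> a -> limn u = a.
Proof. by move=> H; apply: cvg_lim => //; exact: norm_hausdorff. Qed.

Lemma bounded_series (u : nat -> R) (B : R) : (forall n, 0 <= u n) ->
  (forall n, series u n <= B) -> cvgn (series u) /\ limn (series u) <= B.
Proof.
move=> u0 ub.
have nd : nondecreasing_seq (series u) by apply: nondecreasing_series => n _ _; exact: u0.
have cu : cvgn (series u) by apply: nondecreasing_is_cvgn => //; exists B => _ [n _ <-].
by split => //; apply: limr_le => //; exact: nearW.
Qed.

Lemma series_le_lim (u : nat -> R) n : (forall n, 0 <= u n) -> cvgn (series u) ->
  series u n <= limn (series u).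
Proof.
move=> u0 cu; apply: nondecreasing_cvgn_le => //.
by apply: nondecreasing_series => k _ _; exact: u0.
Qed.

Lemma series_summable_le (u v : nat -> R) : (forall n, 0 <= u n <= v n) ->
  cvgn (series v) -> cvgn (series u).
Proof.
move=> H readout; apply: (series_le_cvg _ _ _ readout) => n; have /andP[h1 h2] := H n => //.
exact: le_trans h2.
Qed.

Lemma abs_summableC (u : nat -> C R) : cvgn (series (fun n => cmod (u n))) -> cvgn (series u).
Proof.
move=> cu.
have cre : cvgn (series (fun n => complex.Re (u n))).
  by apply: normed_cvg; apply: series_summable_le cu => n; rewrite normr_ge0 Re_cmod.
have cim : cvgn (series (fun n => complex.Im (u n))).
  by apply: normed_cvg; apply: series_summable_le cu => n; rewrite normr_ge0 Im_cmod.
apply/cvg_ex; exists (Complex (limn (series (fun n =>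
  complex.Re (u n)))) (limn (series (fun n => complex.Im (u n))))).
apply: cvgC_ReIm.
  have -> : (fun n => complex.Re (series u n)) = series (fun n => complex.Re (u n)).
    by apply/funext => n; rewrite /series /= raddf_sum.
  exact: cre.
have -> : (fun n => complex.Im (series u n)) = series (fun n => complex.Im (u n)).
  by apply/funext => n; rewrite /series /= raddf_sum.
exact: cim.
Qed.

End ComplexModulus.

(** * Uniqueness and existence of Taylor expansions *)

Section PowerSeries.
Variable R : realType.
Implicit Types (a b : nat -> C R) (z : C R).

Lemma disc_cmod (z : disc R) : cmod (val z) < 1.
Proof. by have := svalP z; rewrite norm_cmod /cplx -[1]/(cplx 1) ltcR. Qed.

(** Convergence at 1/2 bounds the coefficients by B 2^k; if b_k is the first
nonzero one, then dividing the sum by z^k and letting z tend to 0 along the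
positive reals forces b_k = 0. *)
Lemma power_series_eq0 b :
  (forall z, z != 0 -> cmod z < 1 -> series (fun k => b k * z ^+ k) @ \oo --> (0 : C R)) ->
  forall k, b k = 0.
Proof.
move=> bz.
have [B [B0 bB]] : exists B, 0 <= B /\ forall k, cmod (b k) <= B * 2 ^+ k.
  (* the terms at the point 1/2 tend to 0, hence are bounded *)
  have h0 : cplx (2^-1 : R) != 0.
    by apply/eqP => /(congr1 (@cmod R)); rewrite cmod_cplx cmod0 ger0_norm ?invr_ge0 //; lra.
  have h1 : cmod (cplx (2^-1 : R)) < 1 by rewrite cmod_cplx ger0_norm ?invr_ge0 //; lra.
  have cu := bz _ h0 h1.
  have {cu} := @cvg_series_cvg_0 _ _ _ (cvgP _ cu).
  move=> /cvgC_cmod cm.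
  have [B HB] := cvg_has_ub (cvgP _ cm).
  exists B; split.
    by apply: le_trans (HB _ (ex_intro2 _ _ 0%N I erefl)).
  move=> k; have := HB _ (ex_intro2 _ _ k I erefl).
  rewrite subr0 ger0_norm ?cmod_ge0 // cmodM cmodX cmod_cplx ger0_norm ?invr_ge0 //.
  by rewrite exprVn ler_pdivrMr // exprn_gt0.
move=> k; elim/ltn_ind: k => k IH.
apply/cmod_eq0/eqP; rewrite eq_le cmod_ge0 andbT.
(* the remainder after the term of index k is at most 2 B (2t)^(k+1) at z = t *)
have key (t : R) : 0 < t -> t <= 4^-1 -> cmod (b k) <= B * 2 ^+ k.+2 * t.
  move=> t0 t4; set z := cplx t.
  have mz : cmod z = t by rewrite cmod_cplx ger0_norm // ltW.
  have z0 : z != 0 by apply/eqP => /(congr1 (@cmod R)); rewrite mz cmod0; lra.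
  have z1 : cmod z < 1 by rewrite mz; lra.
  have /cvgC_cmod cS := bz z z0 z1.
  pose r := 2 * t.
  have r0 : 0 <= r by rewrite /r mulr_ge0 // ltW.
  have r1 : r <= 2^-1 by rewrite /r; lra.
  have rest n : exists2 x : C R, series (fun k => b k * z ^+ k) (k.+1 + n)%N = b k * z ^+ k + x
      & cmod x <= B * r ^+ k.+1 * (2 - 2 * 2^-1 ^+ n).
    elim: n => [|n [x Ex bx]].
      exists 0; last by rewrite expr0 mulr1 subrr mulr0 cmod0.
      rewrite addn0 addr0 /series /= big_nat_recr //= big_nat big1 ?add0r // => i /andP[_ ik].
      by rewrite IH ?mul0r.
    exists (x + b (k.+1 + n)%N * z ^+ (k.+1 + n)).
      by rewrite addnS seriesSr Ex addrA.
    apply: le_trans (cmodD _ _) _.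
    have h1 : cmod (b (k.+1 + n)%N * z ^+ (k.+1 + n)) <= B * r ^+ k.+1 * 2^-1 ^+ n.
      rewrite cmodM cmodX mz.
      have : cmod (b (k.+1 + n)%N) * t ^+ (k.+1 + n) <= B * 2 ^+ (k.+1 + n) * t ^+ (k.+1 + n).
        by rewrite ler_wpM2r // exprn_ge0 // ltW.
      move/le_trans; apply; rewrite -mulrA -exprMn exprD mulrA.
      by rewrite ler_wpM2l ?mulr_ge0 ?exprn_ge0 // lerXn2r ?nnegrE // invr_ge0.
    apply: le_trans (lerD bx h1) _; rewrite (exprS _ n); set X := B * _; set h := _ ^+ n; nra.
  have lim : cmod (b k) * t ^+ k <= B * r ^+ k.+1 * 2.
    rewrite -[leRHS]add0r.
    have : (cmod (series (fun k => b k * z ^+ k) n - 0) + B * r ^+ k.+1 * 2) @[n --> \oo]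
      --> 0 + B * r ^+ k.+1 * 2 by apply: cvgD => //; exact: cvg_cst.
    move=> cl; apply: (cvgr_to_ge cl); exists k.+1 => // n /= kn.
    have [x Ex bx] := rest (n - k.+1)%N; rewrite subnKC // in Ex.
    rewrite subr0 Ex.
    have -> : cmod (b k) * t ^+ k = cmod (b k * z ^+ k + x - x) by rewrite addrK cmodM cmodX mz.
    apply: le_trans (cmodD _ _) _; rewrite cmodN lerD2l (le_trans bx) //.
    by rewrite ler_wpM2l ?mulr_ge0 ?exprn_ge0 // lerBlDr lerDl mulr_ge0 // exprn_ge0 // invr_ge0.
  have tk : 0 < t ^+ k by rewrite exprn_gt0.
  rewrite -(ler_pM2r tk) (le_trans lim) // /r exprMn !exprS le_eqVlt; apply/orP; left;
    apply/eqP; ring.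
apply/ler_addgt0Pr => e e0; rewrite add0r.
pose D := B * 2 ^+ k.+2 + 1.
have D0 : 0 < D by rewrite /D ltr_wpDl // mulr_ge0 // exprn_ge0.
pose t := Num.min (4^-1) (e / D).
have t0 : 0 < t by rewrite /t lt_min invr_gt0 ltr0n /= divr_gt0.
apply: le_trans (key t t0 _) _; first by rewrite /t ge_min lexx.
apply: (@le_trans _ _ (D * t)); first by rewrite ler_wpM2r ?ltW // /D ltrDl.
by rewrite mulrC -ler_pdivlMr // /t ge_min lexx orbT.
Qed.

Lemma taylor_unique (f : disc R -> C R) a b : has_taylor f a -> has_taylor f b -> a = b.
Proof.
move=> fa fb; apply/funext => k; apply/eqP; rewrite -subr_eq0; apply/eqP; move: k.
apply: power_series_eq0 => z _ z1.
have z1' : `|z| < 1 by rewrite norm_cmod /cplx -[1]/(cplx 1) ltcR.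
have := cvgCB (fa (exist _ z z1')) (fb (exist _ z z1')); rewrite subrr /=.
apply: eq_cvgC => n /=.
by rewrite /series /= -sumrB; apply: eq_bigr => i _; rewrite mulrBl.
Qed.

Lemma taylorE (f : disc R -> C R) a : has_taylor f a -> taylor f = a.
Proof.
move=> fa; apply: (taylor_unique _ fa).
exact: (@xgetPex _ (fun=> 0) (has_taylor f) (ex_intro _ a fa)).
Qed.

(** By |a_k| |z|^k <= |a_k|^2 + |z|^(2k). *)
Lemma square_summable_taylor a (z : disc R) : square_summable a ->
  cvgn (series (fun k => cmod (a k) * cmod (val z) ^+ k)).
Proof.
move=> sa; pose r := cmod (val z).
have r0 : 0 <= r := cmod_ge0 _.
have r1 : r < 1 := disc_cmod z.
have cg : cvgn (series (geometric 1 (r ^+ 2))).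
  apply: is_cvg_geometric_series; rewrite ger0_norm ?exprn_ge0 //.
  by rewrite exprn_ilt1.
have cs : cvgn (series ((fun k => cmod (a k) ^+ 2) + geometric 1 (r ^+ 2))).
  by apply: is_cvg_seriesD.
apply: series_summable_le cs => k; rewrite mulr_ge0 ?cmod_ge0 ?exprn_ge0 //=.
rewrite -[leRHS]/(_ + _) /geometric /= mul1r -exprM mulnC exprM -/r.
exact: mul_le_sqr.
Qed.

Definition powfun a : disc R -> C R := fun z : disc R => limn (series (fun k =>
  a k * val z ^+ k)).

Lemma powfun_taylor a : square_summable a -> has_taylor (powfun a) a.
Proof.
move=> sa z; apply: (@abs_summableC _ (fun k => a k * val z ^+ k)).
have -> : (fun n => cmod (a n * val z ^+ n)) = (fun n => cmod (a n) * cmod (val z) ^+ n).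
  by apply/funext => n; rewrite cmodM cmodX.
exact: square_summable_taylor.
Qed.

End PowerSeries.

(** * The Hilbert space of square-summable vector sequences *)

Section ColumnVectors.
Variables (R : realType) (n : nat).
Implicit Types (x y : 'cV[C R]_n).

Definition colsq x : R := \sum_q cmod (x q 0) ^+ 2.
Definition coldot x y : C R := \sum_q x q 0 * (y q 0)^*.

Lemma colsq_ge0 x : 0 <= colsq x.
Proof. by apply: sumr_ge0 => q _; rewrite exprn_ge0 ?cmod_ge0. Qed.

Lemma colsq_entry x q : cmod (x q 0) ^+ 2 <= colsq x.
Proof.
by rewrite /colsq (bigD1 q) //= lerDl sumr_ge0 // => i _; rewrite exprn_ge0 ?cmod_ge0.
Qed.

Lemma colsq_eq0 x : colsq x = 0 -> x = 0.
Proof.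
move=> x0; apply/matrixP => q j; rewrite (ord1 j) mxE; apply: cmod_eq0.
apply/eqP; rewrite -sqrf_eq0 eq_le exprn_ge0 ?cmod_ge0 // andbT -x0; exact: colsq_entry.
Qed.

Lemma colsqZ c x : colsq (c *: x) = cmod c ^+ 2 * colsq x.
Proof. by rewrite /colsq mulr_sumr; apply: eq_bigr => q _; rewrite !mxE cmodM exprMn. Qed.

Lemma colsqD x y : colsq (x + y) <= 2 * colsq x + 2 * colsq y.
Proof.
rewrite /colsq !mulr_sumr -big_split /=; apply: ler_sum => q _; rewrite mxE.
have h := cmodD (x q 0) (y q 0).
have : cmod (x q 0 + y q 0) ^+ 2 <= (cmod (x q 0) + cmod (y q 0)) ^+ 2.
  by rewrite lerXn2r ?nnegrE ?addr_ge0 ?cmod_ge0.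
by move/le_trans; apply; exact: sqrD_le.
Qed.

Lemma coldotv x : coldot x x = cplx (colsq x).
Proof. by rewrite /coldot /colsq /cplx rmorph_sum; apply: eq_bigr => q _; rewrite cmod_mulC. Qed.

Lemma coldotC x y : coldot y x = (coldot x y)^*.
Proof. by rewrite /coldot rmorph_sum; apply: eq_bigr => q _; rewrite rmorphM /= conjCK mulrC. Qed.

Lemma coldot_le x y : cmod (coldot x y) <= colsq x + colsq y.
Proof.
apply: le_trans (cmod_sum _ _ _) _.
rewrite /colsq -big_split /=; apply: ler_sum => q _.
by rewrite cmodM cmod_conj mul_le_sqr.
Qed.

Definition sqsum (a : nat -> 'cV[C R]_n) : Prop := cvgn (series (fun k => colsq (a k)) : nat ->
  R).

(** Boolean form of [sqsum], so that [ell2] inherits its module structure as a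
subtype of the module of all sequences. *)
Definition ell2_pred : {pred nat -> 'cV[C R]_n} := fun a => `[< sqsum a >].

Lemma ell2_submod_closed : submod_closed ell2_pred.
Proof.
split.
  apply/asboolP; rewrite /sqsum.
  have -> : series (fun k => colsq ((0 : nat -> 'cV[C R]_n) k)) = fun=> 0.
    apply/funext => N; rewrite /series /= big1 // => i _.
    by rewrite /colsq big1 // => q _; rewrite mxE cmod0 expr0n.
  exact: is_cvg_cst.
move=> c a b /asboolP sa /asboolP sb; apply/asboolP.
have cs : cvgn (series ((2 * cmod c ^+ 2) *: (fun k => colsq (a k)) + 2 *: (fun k =>
  colsq (b k)) : nat -> R)).
  by apply: is_cvg_seriesD; apply: is_cvg_seriesZ.
apply: series_summable_le cs => k; rewrite colsq_ge0 /=.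
by apply: le_trans (colsqD _ _) _; rewrite colsqZ mulrA.
Qed.

HB.instance Definition _ := GRing.isSubmodClosed.Build (C R) (nat ->
  'cV[C R]_n) ell2_pred ell2_submod_closed.

Record ell2 := Ell2 { ell2_fun :> nat -> 'cV[C R]_n ; _ : ell2_fun \in ell2_pred }.

HB.instance Definition _ := [isSub for ell2_fun].
HB.instance Definition _ := [Choice of ell2 by <:].
HB.instance Definition _ := [SubChoice_isSubLmodule of ell2 by <:].

End ColumnVectors.

Section InnerProduct.
Variables (R : realType) (n : nat).
Implicit Types (a b d : ell2 R n) (c : C R).

Lemma ell2_sqsum a : sqsum a.
Proof. by case: a => f /= /asboolP. Qed.

Definition mk_ell2 (f : nat -> 'cV[C R]_n) (fP : sqsum f) : ell2 R n := Ell2 (asboolT fP).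

Lemma ell2_eq a b : (forall k, a k = b k) -> a = b.
Proof. by move=> ab; apply: val_inj; apply/funext. Qed.

Lemma ell2D a b k : (a + b) k = a k + b k. Proof. by []. Qed.
Lemma ell2N a k : (- a) k = - a k. Proof. by []. Qed.
Lemma ell2Z c a k : (c *: a) k = c *: a k. Proof. by []. Qed.
Lemma ell2_sum I (r : seq I) (P : pred I) (F : I -> ell2 R n) k :
  (\sum_(i <- r | P i) F i) k = \sum_(i <- r | P i) F i k.
Proof. by elim/big_rec2: _ => // i x y _ <-. Qed.

Definition sqnorm a : R := limn (series (fun k => colsq (a k))).
Definition iprod a b : C R := limn (series (fun k => coldot (a k) (b k))).

Lemma sqnorm_cvg a : series (fun k => colsq (a k)) @ \oo --> sqnorm a.
Proof. exact: ell2_sqsum. Qed.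

(** Absolute convergence, from |x y| <= |x|^2 + |y|^2. *)
Lemma iprod_cvg a b : series (fun k => coldot (a k) (b k)) @ \oo --> iprod a b.
Proof.
apply: (@abs_summableC _ (fun k => coldot (a k) (b k))).
have cs : cvgn (series ((fun k => colsq (a k)) + (fun k => colsq (b k)) : nat -> R)).
  by apply: is_cvg_seriesD; apply: ell2_sqsum.
by apply: series_summable_le cs => k; rewrite cmod_ge0 /=; apply: coldot_le.
Qed.

Lemma sqnorm_partial a N : \sum_(0 <= k < N) colsq (a k) <= sqnorm a.
Proof. by apply: (@series_le_lim _ (fun k => colsq (a k))) => [k|];
  [exact: colsq_ge0|exact: ell2_sqsum]. Qed.

Lemma sqnorm_le a (B : R) : (forall N, \sum_(0 <= k < N) colsq (a k) <= B) -> sqnorm a <= B.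
Proof.
by move=> H; have [] := @bounded_series _ (fun k => colsq (a k)) B (fun=> colsq_ge0 _) H.
Qed.

Lemma sqsum_bounded (f : nat -> 'cV[C R]_n) (B : R) :
  (forall N, \sum_(0 <= k < N) colsq (f k) <= B) -> sqsum f.
Proof.
by move=> H; have [] := @bounded_series _ (fun k => colsq (f k)) B (fun=> colsq_ge0 _) H.
Qed.

Lemma sqnorm_ge0 a : 0 <= sqnorm a.
Proof. by apply: le_trans (sqnorm_partial a 0); rewrite big_geq. Qed.

Lemma sqnorm_coef a k : colsq (a k) <= sqnorm a.
Proof.
apply: le_trans (sqnorm_partial a k.+1); rewrite big_nat_recr //= lerDr.
by apply: sumr_ge0 => i _; exact: colsq_ge0.
Qed.

Lemma sqnorm_entry a k q : cmod (a k q 0) ^+ 2 <= sqnorm a.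
Proof. exact: le_trans (colsq_entry _ _) (sqnorm_coef _ _). Qed.

Lemma sqnorm_eq0 a : sqnorm a = 0 -> a = 0.
Proof.
move=> a0; apply: ell2_eq => k; apply: colsq_eq0; apply/eqP.
by rewrite eq_le colsq_ge0 andbT -a0 sqnorm_coef.
Qed.

Lemma iprodDl a b d : iprod (a + b) d = iprod a d + iprod b d.
Proof.
apply: cvgC_lim; rewrite (_ : series _ = fun N => series (fun k =>
  coldot (a k) (d k)) N + series (fun k => coldot (b k) (d k)) N).
  by apply: cvgD; exact: iprod_cvg.
apply/funext => N; rewrite /series /= -big_split /=; apply: eq_bigr => k _.
by rewrite /coldot -big_split; apply: eq_bigr => q _; rewrite mxE mulrDl.
Qed.

Lemma iprodZl c a b : iprod (c *: a) b = c * iprod a b.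
Proof.
apply: cvgC_lim; rewrite (_ : series _ = fun N => c * series (fun k => coldot (a k) (b k)) N).
  by apply: cvgM; [exact: cvg_cst|exact: iprod_cvg].
apply/funext => N; rewrite /series /= mulr_sumr; apply: eq_bigr => k _.
by rewrite /coldot mulr_sumr; apply: eq_bigr => q _; rewrite mxE mulrA.
Qed.

Lemma iprodC a b : iprod b a = (iprod a b)^*.
Proof.
apply: cvgC_lim; rewrite (_ : series _ = fun N => (series (fun k => coldot (a k) (b k)) N)^*).
  by apply: cvgC_conj; exact: iprod_cvg.
apply/funext => N; rewrite /series /= rmorph_sum; apply: eq_bigr => k _; exact: coldotC.
Qed.

Lemma iprod_sqnorm a : iprod a a = cplx (sqnorm a).
Proof.
apply: cvgC_lim; rewrite (_ : series _ = fun N => cplx (series (fun k => colsq (a k)) N)).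
  by apply: cvgC_cplx; exact: sqnorm_cvg.
apply/funext => N; rewrite /series /= /cplx rmorph_sum; apply: eq_bigr => k _; exact: coldotv.
Qed.

Lemma iprod0l a : iprod 0 a = 0. Proof. by rewrite -(scale0r 0) iprodZl mul0r. Qed.
Lemma iprod0r a : iprod a 0 = 0. Proof. by rewrite iprodC iprod0l conjC0. Qed.
Lemma iprodNl a b : iprod (- a) b = - iprod a b. Proof. by rewrite -scaleN1r iprodZl mulN1r. Qed.
Lemma iprodNr a b : iprod a (- b) = - iprod a b. Proof.
  by rewrite iprodC iprodNl rmorphN /= -iprodC. Qed.
Lemma iprodDr a b d : iprod d (a + b) = iprod d a + iprod d b.
Proof. by rewrite iprodC iprodDl rmorphD /= -!iprodC. Qed.
Lemma iprodBl a b d : iprod (a - b) d = iprod a d - iprod b d. Proof.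
  by rewrite iprodDl iprodNl. Qed.
Lemma iprodBr a b d : iprod d (a - b) = iprod d a - iprod d b. Proof.
  by rewrite iprodDr iprodNr. Qed.
Lemma iprodZr c a b : iprod a (c *: b) = c^* * iprod a b.
Proof. by rewrite iprodC iprodZl rmorphM /= -iprodC. Qed.
Lemma iprod_suml I (r : seq I) (P : pred I) (F : I -> ell2 R n) b :
  iprod (\sum_(i <- r | P i) F i) b = \sum_(i <- r | P i) iprod (F i) b.
Proof. by elim/big_rec2: _ => [|i x y _ <-]; rewrite ?iprod0l ?iprodDl. Qed.
Lemma iprod_sumr I (r : seq I) (P : pred I) (F : I -> ell2 R n) b :
  iprod b (\sum_(i <- r | P i) F i) = \sum_(i <- r | P i) iprod b (F i).
Proof. by elim/big_rec2: _ => [|i x y _ <-]; rewrite ?iprod0r ?iprodDr. Qed.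

Lemma sqnorm_Re a : sqnorm a = complex.Re (iprod a a). Proof. by rewrite iprod_sqnorm. Qed.

Lemma sqnormD a b : sqnorm (a + b) = sqnorm a + sqnorm b + 2 * complex.Re (iprod a b).
Proof.
rewrite !sqnorm_Re iprodDl !iprodDr (iprodC a b).
case: (iprod a a) => x1 x2; case: (iprod b b) => y1 y2; case: (iprod a b) => z1 z2 /=; ring.
Qed.

Lemma sqnormN a : sqnorm (- a) = sqnorm a.
Proof. by rewrite !sqnorm_Re iprodNl iprodNr opprK. Qed.

Lemma sqnormB a b : sqnorm (a - b) = sqnorm a + sqnorm b - 2 * complex.Re (iprod a b).
Proof. by rewrite sqnormD sqnormN iprodNr; case: (iprod a b) => x y /=; ring. Qed.

Lemma sqnormBC a b : sqnorm (a - b) = sqnorm (b - a). Proof. by rewrite -sqnormN opprB. Qed.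

Lemma sqnormZ c a : sqnorm (c *: a) = cmod c ^+ 2 * sqnorm a.
Proof.
apply: cplx_inj; rewrite -iprod_sqnorm iprodZl iprodZr mulrA cmod_mulC iprod_sqnorm.
by rewrite cplxM.
Qed.

Lemma sqnorm0 : sqnorm 0 = 0. Proof. by rewrite sqnorm_Re iprod0l. Qed.

Lemma parallelogram a b : sqnorm (a + b) + sqnorm (a - b) = 2 * sqnorm a + 2 * sqnorm b.
Proof. rewrite sqnormD sqnormB; ring. Qed.

Lemma sqnormD_le2 a b : sqnorm (a + b) <= 2 * sqnorm a + 2 * sqnorm b.
Proof. by rewrite -parallelogram lerDl sqnorm_ge0. Qed.

Lemma sqnormB_le2 a b : sqnorm (a - b) <= 2 * sqnorm a + 2 * sqnorm b.
Proof. by rewrite -parallelogram lerDr sqnorm_ge0. Qed.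

Lemma pythagoras a b : iprod a b = 0 -> sqnorm (a + b) = sqnorm a + sqnorm b.
Proof. by move=> h; rewrite sqnormD h mulr0 addr0. Qed.

(** Positivity of the squared norm of |b|^2 a - <a,b> b. *)
Lemma cauchy_schwarz a b : cmod (iprod a b) ^+ 2 <= sqnorm a * sqnorm b.
Proof.
have [b0|b0] := eqVneq (sqnorm b) 0.
  by rewrite b0 mulr0 (sqnorm_eq0 b0) iprod0r cmod0 expr0n.
have bp : 0 < sqnorm b by rewrite lt_neqAle eq_sym b0 sqnorm_ge0.
set t := iprod a b.
have := sqnorm_ge0 ((cplx (sqnorm b)) *: a - t *: b).
rewrite sqnormB !sqnormZ iprodZl iprodZr -/t cmod_cplx (ger0_norm (sqnorm_ge0 b)).
have -> : cplx (sqnorm b) * (t^* * t) = cplx (sqnorm b * cmod t ^+ 2).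
  by rewrite [t^* * t]mulrC cmod_mulC cplxM.
rewrite /cplx /= => H.
rewrite -(ler_pM2l bp).
move: H; rewrite [sqnorm b ^+ 2]expr2.
move: (sqnorm b) (sqnorm a) (cmod t ^+ 2) => x y z.
nra.
Qed.

Definition cvg_ell2 (x : nat -> ell2 R n) (l : ell2 R n) := sqnorm (x k - l) @[k --> \oo]
  --> (0 : R).

Lemma sqrt_cvg0 (u : nat -> R) : (u k) ^+ 2 @[k --> \oo] --> (0:R) -> u @ \oo --> (0 : R).
Proof.
move=> /cvgrPdist_lt H; apply/cvgrPdist_lt => e e0.
have /H : 0 < e ^+ 2 by rewrite exprn_gt0.
apply: filterS => k; rewrite !sub0r !normrN normrX.
by rewrite ltr_pXn2r // nnegrE ltW.
Qed.

Lemma cvg0Z (B : R) (u : nat -> R) : u @ \oo --> (0 : R) -> (B * u k) @[k --> \oo] --> (0 : R).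
Proof. by move=> cu; rewrite -(mulr0 B); apply: cvgM; [exact: cvg_cst|exact: cu]. Qed.

Lemma cvg_ell2_iprod x l b : cvg_ell2 x l -> iprod (x k) b @[k --> \oo] --> iprod l b.
Proof.
move=> xl; apply/cvgC_cmod; apply: (@sqrt_cvg0 (fun k => cmod (iprod (x k) b - iprod l b))).
apply: (cvg_to0_le _ (cvg0Z (sqnorm b) xl)) => k.
by rewrite exprn_ge0 ?cmod_ge0 //= -iprodBl mulrC cauchy_schwarz.
Qed.

Lemma cvg_ell2_coef x l k q : cvg_ell2 x l -> x i k q 0 @[i --> \oo] --> l k q 0.
Proof.
move=> xl; apply/cvgC_cmod; apply: (@sqrt_cvg0 (fun i => cmod (x i k q 0 - l k q 0))).
apply: (cvg_to0_le _ xl) => i; rewrite exprn_ge0 ?cmod_ge0 //=.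
by apply: le_trans (sqnorm_entry _ k q); rewrite ell2D ell2N !mxE.
Qed.

Lemma cvg_ell2_sqnorm x l : cvg_ell2 x l -> sqnorm (x k) @[k --> \oo] --> sqnorm l.
Proof.
move=> xl.
have e k : sqnorm (x k) - sqnorm l = sqnorm (x k - l) + 2 * complex.Re (iprod (x k) l -
  iprod l l).
  by have := sqnormD (x k - l) l; rewrite subrK iprodBl => ->; ring.
apply/subr_cvg0.
rewrite (_ : (fun k => _) = fun k =>
  sqnorm (x k - l) + 2 * complex.Re (iprod (x k) l - iprod l l)); last first.
  by apply/funext => k; exact: e.
apply: cvg0D => //; apply: cvg0Z.
have /cvgC_Re : (iprod (x k) l - iprod l l) @[k --> \oo] --> (iprod l l - iprod l l).
  by apply: cvgCB; [exact: cvg_ell2_iprod|exact: cvg_cst].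
by rewrite subrr.
Qed.

End InnerProduct.

(** * Completeness and orthogonal projection *)

Section Complete.
Variables (R : realType).

Lemma eq_cvgR (u v : nat -> R) (l : R) : u =1 v -> u @ \oo --> l -> v @ \oo --> l.
Proof. by move=> /funext ->. Qed.

Lemma cvgn_sqr (u : nat -> R) (l : R) : u @ \oo --> l -> (u k ^+ 2) @[k --> \oo] --> l ^+ 2.
Proof.
move=> ul; rewrite expr2; apply: (@eq_cvgR (fun k => u k * u k)) => [k|]; first by rewrite expr2.
exact: cvgM.
Qed.

Lemma cvgn_sum (I : Type) (r : seq I) (F : I -> nat -> R) (l : I -> R) :
  (forall i, F i @ \oo --> l i) -> (\sum_(i <- r) F i k) @[k --> \oo] --> \sum_(i <- r) l i.
Proof.
move=> H; elim: r => [|i r IH].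
  by rewrite big_nil (_ : (fun k => _) = fun=> 0); [exact: cvg_cst|apply/funext => k;
    rewrite big_nil].
rewrite big_cons (_ : (fun k => _) = fun k => F i k + \sum_(j <- r) F j k).
  exact: cvgD.
by apply/funext => k; rewrite big_cons.
Qed.

Lemma cauchy_cvgC (u : nat -> C R) :
  (forall e : R, 0 < e -> exists N, forall i j, (N <= i)%N -> (N <= j)%N ->
    cmod (u i - u j) <= e) ->
  exists l : C R, u @ \oo --> l.
Proof.
move=> H.
have cau (f : C R -> R) : (forall x y, `|f x - f y| <= cmod (x - y)) -> cvgn (f \o u).
  move=> fl; apply/cauchy_cvgP; apply: cauchy_exP => e e0.
  have e2 : 0 < e / 2 by rewrite divr_gt0.
  have [N HN] := H _ e2.
  exists (f (u N)); exists N => // k /= Nk; rewrite /ball /=.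
  apply: le_lt_trans (fl _ _) _; apply: le_lt_trans (HN _ _ _ _) _ => //.
  by rewrite gtr_pMr // invf_lt1 // ltr1n.
exists (Complex (limn (@complex.Re R \o u)) (limn (@complex.Im R \o u))).
apply: cvgC_ReIm; apply: cau => x y.
  by rewrite -(raddfB (@complex.Re R)) Re_cmod.
by rewrite -(raddfB (@complex.Im R)) Im_cmod.
Qed.

Lemma cvgC_cmodB (u : nat -> C R) (l x : C R) : u @ \oo --> l ->
  cmod (x - u k) @[k --> \oo] --> cmod (x - l).
Proof.
move=> /cvgC_cmod ul; apply/subr_cvg0/norm_cvg0P.
apply: (cvg_to0_le _ ul) => k; rewrite normr_ge0 /= ler_norml.
have h1 : cmod (x - u k) <= cmod (x - l) + cmod (u k - l).
  by rewrite (cmodB (u k)); apply: le_trans (cmodD _ _); rewrite addrA subrK.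
have h2 : cmod (x - l) <= cmod (x - u k) + cmod (u k - l).
  by apply: le_trans (cmodD _ _); rewrite addrA subrK.
apply/andP; split; lra.
Qed.

Variable n : nat.

(** The coefficients converge entry by entry; the Cauchy bound on finite partial
sums passes to the limit, which makes the limit sequence square summable and
the convergence a convergence in norm. *)
Lemma ell2_complete (x : nat -> ell2 R n) :
  (forall e : R, 0 < e -> exists N, forall i j, (N <= i)%N -> (N <= j)%N ->
    sqnorm (x i - x j) <= e) ->
  exists l, cvg_ell2 x l.
Proof.
move=> H.
have entry_lim k q : exists l : C R, x i k q 0 @[i --> \oo] --> l.
  apply: cauchy_cvgC => e e0.
  have [N HN] := H (e ^+ 2) (exprn_gt0 _ e0); exists N => i j Ni Nj.
  rewrite -(ler_pXn2r (ltn0Sn 1)) ?nnegrE ?cmod_ge0 ?(ltW e0) //.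
  by apply: le_trans (HN i j Ni Nj); apply: le_trans (sqnorm_entry _ k q);
    rewrite ell2D ell2N !mxE.
pose L k : 'cV[C R]_n := \col_q projT1 (cid (entry_lim k q)).
have xL k q : x i k q 0 @[i --> \oo] --> L k q 0.
  by rewrite mxE; exact: (projT2 (cid (entry_lim k q))).
have est (e : R) : 0 < e -> exists N, forall i K, (N <= i)%N ->
    \sum_(0 <= k < K) colsq (x i k - L k) <= e.
  move=> e0; have [N HN] := H e e0; exists N => i K Ni.
  have cl : (\sum_(0 <= k < K) colsq (x i k - x j k)) @[j --> \oo] --> \sum_(0
    <= k < K) colsq (x i k - L k).
    apply: (@cvgn_sum nat _ (fun k j => colsq (x i k - x j k))) => k; rewrite /colsq.
    apply: (@cvgn_sum _ _ (fun q j => cmod ((x i k - x j k) q 0) ^+ 2)) => q; rewrite !mxE.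
    have cj := cvgn_sqr (@cvgC_cmodB _ _ (x i k q 0) (xL k q)); move: cj; rewrite mxE => cj.
    by apply: eq_cvgR cj => j; rewrite !mxE.
  apply: (cvgr_to_le cl); exists N => // j /= Nj.
  by apply: le_trans (HN i j Ni Nj); exact: (@sqnorm_partial _ _ (x i - x j)).
have [N0 HN0] := est 1 ltr01.
have s0 : sqsum (fun k => x N0 k - L k) by apply: (@sqsum_bounded _ _ _ 1) => K; exact: HN0.
pose l := x N0 - mk_ell2 s0.
have lL k : l k = L k by rewrite /l ell2D ell2N /= opprB addrC subrK.
exists l; apply/cvgrPdist_le => e e0.
have [N HN] := est e e0; exists N => // i /= Ni.
rewrite sub0r normrN ger0_norm ?sqnorm_ge0 //; apply: sqnorm_le => K.
by under eq_bigr => k _ do rewrite ell2D ell2N lL; exact: HN.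
Qed.

(** The analogue of [closed_subspace] for sequences. *)
Record closed_sub (N : set (ell2 R n)) : Prop := ClosedSub {
  closed_sub0 : N 0;
  closed_subL : forall c x y, N x -> N y -> N (c *: x + y);
  closed_subC : forall x l, (forall k, N (x k)) -> cvg_ell2 x l -> N l }.

Section ClosedSub.
Variables (N : set (ell2 R n)) (cN : closed_sub N).

Lemma closed_subZ c x : N x -> N (c *: x).
Proof. by move=> Nx; rewrite -[_ *: _]addr0; apply: (closed_subL cN) => //; exact: closed_sub0.
  Qed.
Lemma closed_subD x y : N x -> N y -> N (x + y).
Proof. by move=> Nx Ny; rewrite -[x]scale1r; exact: (closed_subL cN). Qed.
Lemma closed_subB x y : N x -> N y -> N (x - y).
Proof. by move=> Nx Ny; rewrite addrC -scaleN1r; exact: (closed_subL cN). Qed.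
Lemma closed_sub_sum I (r : seq I) (P : pred I) (F : I -> ell2 R n) :
  (forall i, P i -> N (F i)) -> N (\sum_(i <- r | P i) F i).
Proof.
move=> H; elim/big_ind: _ => //; first exact: closed_sub0.
exact: closed_subD.
Qed.

Lemma cvg_ell2_sub (f : ell2 R n) x l : cvg_ell2 x l -> cvg_ell2 (fun k => f - x k) (f - l).
Proof.
rewrite /cvg_ell2 (_ : (fun k => sqnorm (f - x k - (f - l))) = (fun k => sqnorm (x k - l))) //.
by apply/funext => k; rewrite opprB [l - f]addrC addrACA subrr add0r addrC sqnormBC.
Qed.

(** A minimizing sequence is Cauchy by the parallelogram identity, and its limit is
a nearest point; moving the nearest point along h cannot decrease the distance,
which makes f - p orthogonal to h. *)
Lemma projection_exists (f : ell2 R n) :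
  exists p, N p /\ forall g, N g -> iprod (f - p) g = 0.
Proof.
pose A := [set sqnorm (f - g) | g in N].
have A0 : has_inf A.
  split; first by exists (sqnorm (f - 0)), 0 => //; exact: closed_sub0.
  by exists 0 => _ [g _ <-]; exact: sqnorm_ge0.
pose d := inf A.
have dle g : N g -> d <= sqnorm (f - g).
  by move=> Ng; apply: ge_inf; [exact: A0.2|exists g].
have gex k : exists g, N g /\ sqnorm (f - g) < d + k.+1%:R^-1.
  have [_ [g Ng <-] lg] := @inf_adherent _ A (k.+1%:R^-1) ltac:(by rewrite invr_gt0) A0.
  by exists g.
pose g k := projT1 (cid (gex k)).
have Ng k : N (g k) := (projT2 (cid (gex k))).1.
have gd k : sqnorm (f - g k) < d + k.+1%:R^-1 := (projT2 (cid (gex k))).2.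
(* parallelogram identity at f - g i and f - g j: their half sum has squared norm at least d *)
have gap i j : sqnorm (g i - g j) <= 2 * i.+1%:R^-1 + 2 * j.+1%:R^-1.
  have := parallelogram (f - g i) (f - g j).
  have -> : f - g i - (f - g j) = - (g i - g j).
    by rewrite !opprB [g j - f]addrC addrACA subrr add0r addrC.
  rewrite sqnormN.
  have -> : f - g i + (f - g j) = 2 *: (f - (2^-1 *: (g i + g j))).
    rewrite scalerBr scalerA divff ?pnatr_eq0 // scale1r scaler_nat mulr2n addrACA.
    by rewrite -opprD.
  rewrite sqnormZ cmod2.
  have := dle _ (closed_subZ (2^-1) (closed_subD (Ng i) (Ng j))).
  have := gd i; have := gd j.
  move: (sqnorm _) (sqnorm _) (sqnorm _) (sqnorm _) (i.+1%:R^-1) (j.+1%:R^-1) =>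
    r1 r2 r3 r4 r5 r6.
  lra.
have [p gp] : exists p, cvg_ell2 g p.
  apply: ell2_complete => e e0.
  have e4 : 0 < e / 4 by rewrite divr_gt0.
  have := @cvg_harmonic R; move=> /cvgrPdist_lt /(_ _ e4) [M _ HM].
  exists M => i j Mi Mj; apply: le_trans (gap i j) _.
  have := HM i Mi; have := HM j Mj; rewrite /harmonic /= !sub0r !normrN !ger0_norm ?invr_ge0 //.
  move: (i.+1%:R^-1) (j.+1%:R^-1) => r5 r6; lra.
have Np : N p by exact: closed_subC gp.
have dp : sqnorm (f - p) = d.
  apply/eqP; rewrite eq_le dle // andbT.
  have := cvg_ell2_sqnorm (cvg_ell2_sub f gp).
  have cd : (d + k.+1%:R^-1) @[k --> \oo] --> d.
    by rewrite -[X in _ --> X]addr0; apply: cvgD; [exact: cvg_cst|exact: cvg_harmonic].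
  by move=> cs; apply: (ler_cvg_to cs cd); apply: nearW => k; apply: ltW.
exists p; split => // h Nh.
set x := f - p; apply: cmod_eq0; apply/eqP; rewrite -sqrf_eq0; apply/eqP.
set m := cmod (iprod x h) ^+ 2.
have m0 : 0 <= m by rewrite exprn_ge0 ?cmod_ge0.
set s := sqnorm h; have s0 : 0 <= s := sqnorm_ge0 h.
(* any step with s * t < 2 contradicts minimality unless m = 0 *)
pose t := (s + 1)^-1.
have t0 : 0 < t by rewrite invr_gt0; lra.
pose c := cplx t * iprod x h.
have := dle (p + c *: h) (closed_subD Np (closed_subZ c Nh)).
rewrite -dp opprD addrA -/x; clearbody x; rewrite (sqnormB x) sqnormZ iprodZr -/s.
have -> : cmod c ^+ 2 = t ^+ 2 * m by rewrite /c cmodM cmod_cplx (ger0_norm (ltW t0)) exprMn.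
have -> : c^* * iprod x h = cplx (t * m).
  by rewrite /c rmorphM /= -mulrA [_^* * iprod _ _]mulrC cmod_mulC conj_cplx -cplxM -/m.
rewrite /= => H.
have st : s * t <= 1.
  by rewrite /t ler_pdivrMr; lra.
have H2 : t * m * (2 - s * t) <= 0 by move: H; rewrite expr2; lra.
have : t * m <= 0.
  rewrite -(@pmulr_lle0 _ (2 - s * t)) //; lra.
rewrite pmulr_rle0 // => m1; apply/eqP; rewrite eq_le m1 m0 //.
Qed.

Definition orth_proj (f : ell2 R n) : ell2 R n :=
  xget 0 [set p | N p /\ forall g, N g -> iprod (f - p) g = 0].

Lemma orth_projP f : N (orth_proj f) /\ forall g, N g -> iprod (f - orth_proj f) g = 0.
Proof.
exact: (@xgetPex _ 0 [set p | N p /\ forall g, N g -> iprod (f - p) g = 0] (projection_exists f)).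
Qed.

Lemma orth_proj_in f : N (orth_proj f). Proof. by have [] := orth_projP f. Qed.

Lemma orth_proj_iprod f g : N g -> iprod (orth_proj f) g = iprod f g.
Proof. by move=> Ng; have [_ /(_ g Ng)] := orth_projP f; rewrite iprodBl => /subr0_eq ->. Qed.

End ClosedSub.
End Complete.

(** * Forward and backward shift of sequences *)

Section Shifts.
Variables (R : realType) (n : nat).
Implicit Types (a b : ell2 R n) (c : C R).

Definition shift_fun (a : nat -> 'cV[C R]_n) (k : nat) : 'cV[C R]_n := if k is k'.+1 then a k'
  else 0.

Lemma colsq0 : colsq (0 : 'cV[C R]_n) = 0.
Proof. by rewrite /colsq big1 // => q _; rewrite mxE cmod0 expr0n. Qed.

Lemma fshift_sqsum a : sqsum (shift_fun a).
Proof.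
apply: (@sqsum_bounded _ _ _ (sqnorm a)) => -[|N]; first by rewrite big_geq // sqnorm_ge0.
by rewrite big_nat_recl //= colsq0 add0r sqnorm_partial.
Qed.

Lemma bshift_sqsum a : sqsum (fun k => a k.+1).
Proof.
apply: (@sqsum_bounded _ _ _ (sqnorm a)) => N; apply: le_trans (sqnorm_partial a N.+1).
by rewrite big_nat_recl //= lerDr colsq_ge0.
Qed.

Definition fshift a := mk_ell2 (@fshift_sqsum a).
Definition bshift a := mk_ell2 (@bshift_sqsum a).

Lemma bshiftE a k : bshift a k = a k.+1. Proof. by []. Qed.
Lemma fshift0 a : fshift a 0%N = 0. Proof. by []. Qed.
Lemma bshiftD a b : bshift (a + b) = bshift a + bshift b. Proof. exact: ell2_eq. Qed.
Lemma bshiftZ c a : bshift (c *: a) = c *: bshift a. Proof. exact: ell2_eq. Qed.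
Lemma bshift_fshift a : bshift (fshift a) = a. Proof. exact: ell2_eq. Qed.
Lemma fshift_bshift a : a 0%N = 0 -> fshift (bshift a) = a.
Proof. by move=> a0; apply: ell2_eq => -[|k]. Qed.

Lemma iter_bshift a N k : iter N bshift a k = a (N + k)%N.
Proof. by elim: N k => [|N IH] k //=; rewrite IH addnS. Qed.

Lemma iprod_shift a b : iprod (bshift a) b = iprod a (fshift b).
Proof.
apply: cvgC_lim; have := @iprod_cvg _ _ a (fshift b).
move/(cvg_comp _ _ (cvg_addnr 1)) => h; apply: eq_cvgC h => N.
rewrite /series /= addn1 big_nat_recl //= {1}/coldot big1 ?add0r //.
by move=> q _; rewrite mxE conjC0 mulr0.
Qed.

Lemma sqnorm_bshift a : sqnorm a = colsq (a 0%N) + sqnorm (bshift a).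
Proof.
have h : (colsq (a 0%N) + series (fun k =>
  colsq (bshift a k)) N) @[N --> \oo] --> colsq (a 0%N) + sqnorm (bshift a).
  by apply: cvgD; [exact: cvg_cst|exact: sqnorm_cvg].
have := @sqnorm_cvg _ _ a; move/(cvg_comp _ _ (cvg_addnr 1)) => h1.
have {}h1 : (colsq (a 0%N) + series (fun k => colsq (bshift a k)) N) @[N --> \oo] --> sqnorm a.
  by apply: eq_cvgR h1 => N; rewrite /series /= addn1 big_nat_recl.
by apply: cvg_unique h1 h; exact: norm_hausdorff.
Qed.

Lemma sqnorm_iter_bshift a N : sqnorm (iter N bshift a) = sqnorm a - \sum_(0
  <= k < N) colsq (a k).
Proof.
elim: N => [|N IH]; first by rewrite big_geq // subr0.
rewrite big_nat_recr //= opprD addrA -IH (sqnorm_bshift (iter N bshift a)) iter_bshift addn0.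
by rewrite addrC addKr.
Qed.

(** The backward shift tends strongly to 0: the squared norms are the tails of a
convergent series. *)
Lemma iter_bshift_to0 a : sqnorm (iter N bshift a) @[N --> \oo] --> (0 : R).
Proof.
rewrite -(subrr (sqnorm a)).
have h : (sqnorm a - series (fun k => colsq (a k)) N) @[N --> \oo] --> sqnorm a - sqnorm a.
  by apply: cvgB; [exact: cvg_cst|exact: sqnorm_cvg].
by apply: eq_cvgR h => N; rewrite sqnorm_iter_bshift.
Qed.

Lemma bshift_sum I (r : seq I) (P : pred I) (F : I -> ell2 R n) :
  bshift (\sum_(i <- r | P i) F i) = \sum_(i <- r | P i) bshift (F i).
Proof.
elim/big_rec2: _ => [|i x y _ <-]; last exact: bshiftD.
exact: ell2_eq.
Qed.

End Shifts.

Arguments bshift {R n} a.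
Arguments fshift {R n} a.

(** * Column vectors and finite sums *)

Section DotAlgebra.
Variables (R : realType) (p : nat).
Implicit Types (x y z : 'cV[C R]_p) (c : C R).

Lemma coldotDl x y z : coldot (x + y) z = coldot x z + coldot y z.
Proof. by rewrite /coldot -big_split; apply: eq_bigr => q _; rewrite mxE mulrDl. Qed.
Lemma coldotZl c x y : coldot (c *: x) y = c * coldot x y.
Proof. by rewrite /coldot mulr_sumr; apply: eq_bigr => q _; rewrite mxE mulrA. Qed.
Lemma coldotDr x y z : coldot z (x + y) = coldot z x + coldot z y.
Proof. by rewrite coldotC coldotDl rmorphD /= -!coldotC. Qed.
Lemma coldotZr c x y : coldot x (c *: y) = c^* * coldot x y.
Proof. by rewrite coldotC coldotZl rmorphM /= -!coldotC. Qed.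
Lemma colsq_Re x : colsq x = complex.Re (coldot x x). Proof. by rewrite coldotv. Qed.
Lemma colsqDE x y : colsq (x + y) = colsq x + colsq y + 2 * complex.Re (coldot x y).
Proof.
rewrite !colsq_Re coldotDl !coldotDr (coldotC x y).
case: (coldot x x) => x1 x2; case: (coldot y y) => y1 y2; case: (coldot x y) => z1 z2 /=; ring.
Qed.

(** Reduces an identity between sesquilinear forms to its real part. *)
Lemma eq_ReI (u v : C R) : complex.Re u = complex.Re v ->
  complex.Re ('i%C * u) = complex.Re ('i%C * v) -> u = v.
Proof.
case: u => a b; case: v => c d /= ->; rewrite !mul0r !mul1r !sub0r => /oppr_inj ->; done.
Qed.

(** The constant is crude; any bound depending only on the number of terms will do. *)
Lemma sqr_sum_le (I : Type) (r : seq I) (t : I -> R) :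
  (\sum_(i <- r) t i) ^+ 2 <= 2 ^+ size r * \sum_(i <- r) t i ^+ 2.
Proof.
elim: r => [|i r IH]; first by rewrite !big_nil expr0n mulr0.
rewrite !big_cons /= (exprS 2) mulrDr.
apply: le_trans (sqrD_le _ _) _; apply: lerD.
  rewrite ler_wpM2r ?sqr_ge0 // ler_peMr // exprn_ege1 // ler1n //.
by rewrite -mulrA ler_wpM2l.
Qed.

End DotAlgebra.

(** * Strong stability of the peeling operator *)

Section Stability.
Variables (R : realType) (n p : nat) (N : set (ell2 R n)) (cN : closed_sub N).
Variables (E h : 'I_p -> ell2 R n).
Hypothesis Nh : forall a, N (h a).
Implicit Types (f g : ell2 R n) (c : C R).

Definition readout f : 'cV[C R]_p := \col_a iprod f (h a).
(** In the application E = (F0, z e_1, ..., z e_m), and what remains after stripping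
is z times an element of N. *)
Definition strip f : ell2 R n := f - \sum_a iprod f (h a) *: E a.
(** The operator T of the introduction: remove the constant data, divide by z. *)
Definition peel f : ell2 R n := bshift (strip f).

Hypothesis peelN : forall f, N f -> N (peel f).
Hypothesis energy : forall f, N f -> sqnorm f = sqnorm (peel f) + colsq (readout f).

Lemma readoutD f g : readout (f + g) = readout f + readout g.
Proof. by apply/matrixP => a j; rewrite !mxE iprodDl. Qed.
Lemma readout0 : readout 0 = 0.
Proof. by apply/matrixP => a j; rewrite !mxE iprod0l. Qed.
Lemma readoutZ c f : readout (c *: f) = c *: readout f.
Proof. by apply/matrixP => a j; rewrite !mxE iprodZl. Qed.

Lemma peelD f g : peel (f + g) = peel f + peel g.
Proof.
rewrite /peel -bshiftD /strip; congr bshift.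
rewrite addrACA -opprD -big_split /=; congr (_ - _).
by apply: eq_bigr => a _; rewrite iprodDl scalerDl.
Qed.

Lemma peelZ c f : peel (c *: f) = c *: peel f.
Proof.
rewrite /peel -bshiftZ /strip scalerBr scaler_sumr; congr (bshift (_ - _)).
by apply: eq_bigr => a _; rewrite iprodZl scalerA.
Qed.

Lemma peel0 : peel 0 = 0.
Proof. by rewrite -(scale0r 0) peelZ !scale0r. Qed.

Lemma iter_peel0 k : iter k peel 0 = 0.
Proof. by elim: k => //= k ->; exact: peel0. Qed.
Lemma iter_peelD k f g : iter k peel (f + g) = iter k peel f + iter k peel g.
Proof. by elim: k => //= k ->; rewrite peelD. Qed.
Lemma iter_peelZ k c f : iter k peel (c *: f) = c *: iter k peel f.
Proof. by elim: k => //= k ->; rewrite peelZ. Qed.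
Lemma iter_peelN k f : N f -> N (iter k peel f).
Proof. by move=> Nf; elim: k => //= k IH; apply: peelN. Qed.

Lemma peel_le f : N f -> sqnorm (peel f) <= sqnorm f.
Proof. by move=> Nf; rewrite (energy Nf) lerDl colsq_ge0. Qed.

Lemma iter_peel_le k f : N f -> sqnorm (iter k peel f) <= sqnorm f.
Proof.
move=> Nf; elim: k => //= k IH; apply: le_trans IH; apply: peel_le; exact: iter_peelN.
Qed.

(** The energy identity, polarized: I - T*T is the Gram operator of [readout]. *)
Lemma polarized f g : N f -> N g ->
  iprod f g = iprod (peel f) (peel g) + coldot (readout f) (readout g).
Proof.
move=> Nf Ng.
have re f1 : N f1 -> complex.Re (iprod f1 g) = complex.Re (iprod (peel f1) (peel g) +
  coldot (readout f1) (readout g)).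
  move=> Nf1; have := energy (closed_subD cN Nf1 Ng).
  rewrite peelD readoutD !sqnormD colsqDE (energy Nf1) (energy Ng).
  case: (iprod f1 g) => x1 x2; case: (iprod _ _) => y1 y2; case: (coldot _ _) => z1 z2 /=.
  move: (sqnorm _) (sqnorm _) (colsq _) (colsq _) => r1 r2 r3 r4; lra.
apply: eq_ReI; first exact: re.
have := re _ (closed_subZ cN 'i%C Nf).
by rewrite peelZ readoutZ !iprodZl coldotZl -mulrDr.
Qed.

(** The adjoint of [peel] on N: as [peel] is the backward shift after a finite-rank
correction, its adjoint is the forward shift followed by the adjoint correction,
projected to N. *)
Definition peel_adj g : ell2 R n :=
  orth_proj N (fshift g) - \sum_a (iprod (E a) (fshift g))^* *: h a.

Lemma peel_adjN g : N (peel_adj g).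
Proof.
apply: closed_subB => //; first exact: orth_proj_in.
by apply: closed_sub_sum => // a _; apply: closed_subZ.
Qed.

Lemma peel_adjP f g : N f -> iprod (peel f) g = iprod f (peel_adj g).
Proof.
move=> Nf; rewrite /peel iprod_shift /strip /peel_adj iprodBl iprodBr iprod_suml iprod_sumr.
congr (_ - _); first by rewrite iprodC (iprodC (orth_proj N _)) orth_proj_iprod.
by apply: eq_bigr => a _; rewrite iprodZl iprodZr conjCK mulrC.
Qed.

Definition adj_defect g := g - peel (peel_adj g).

Lemma adj_defectN g : N g -> N (adj_defect g).
Proof. by move=> Ng; apply: closed_subB => //; apply: peelN; exact: peel_adjN. Qed.

(** The reason for working with g - T T* g: against it, T x is seen only through the
readout of x, so that the cross term of the energy balance is controlled by the
output. *)
Lemma iprod_peel_adj_defect f g : N f -> N g ->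
  iprod (peel f) (adj_defect g) = coldot (readout f) (readout (peel_adj g)).
Proof.
move=> Nf Ng; rewrite iprodBr (peel_adjP _ Nf) (polarized Nf (peel_adjN g)).
by rewrite addrC addKr.
Qed.

Section Driven.
Variables (g : ell2 R n) (Ng : N g).
Implicit Types (s : nat -> C R).

(** State at time k of the system x_(i+1) = T x_i + s_i (g - T T* g), x_0 = 0. *)
Fixpoint state s (k : nat) : ell2 R n :=
  if k is k'.+1 then peel (state s k') + s k' *: adj_defect g else 0.

Lemma stateN s k : N (state s k).
Proof.
elim: k => /= [|k IH]; first exact: closed_sub0.
by apply: closed_subD => //; [exact: peelN|apply: closed_subZ => //; exact: adj_defectN].
Qed.

(** Time invariance: the first input propagates freely, the others act as the
shifted input. *)
Lemma stateS s k : state s k.+1 = s 0%N *: iter k peel (adj_defect g) + state (fun i => s i.+1) k.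
Proof.
elim: k => [|k IH].
  by rewrite /= peel0 add0r addr0.
by rewrite [LHS]/= -/(state s k.+1) IH peelD peelZ -addrA.
Qed.

(** The weight 8 is what remains after half of the output energy has absorbed the
cross term. *)
Definition gain : R := 8 * colsq (readout (peel_adj g)) + sqnorm (adj_defect g).

Lemma state_energy s k : sqnorm (state s k.+1) + 2^-1 * colsq (readout (state s k)) <=
  sqnorm (state s k) + gain * cmod (s k) ^+ 2.
Proof.
rewrite /= sqnormD sqnormZ iprodZr (energy (stateN s k)) (iprod_peel_adj_defect (stateN s k) Ng)
  /gain.
set x := readout _; set y := readout _; set t := s k.
have : complex.Re (t^* * coldot x y) <= 4^-1 * colsq x + 4 * cmod t ^+ 2 * colsq y.
  (* balance the weights, so that a quarter of |x|^2 is spent on the cross term *)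
  have -> : t^* * coldot x y = coldot (cplx (2^-1) *: x) ((2 * t) *: y).
    rewrite coldotZl coldotZr rmorphM /= conjC_nat mulrA mulrA /cplx fmorphV rmorph_nat.
    by rewrite mulVf ?pnatr_eq0 // mul1r.
  apply: le_trans (ler_norm _) _; apply: le_trans (Re_cmod _) _.
  apply: le_trans (coldot_le _ _) _; rewrite !colsqZ cmod_cplx cmodM cmod2.
  rewrite ger0_norm ?invr_ge0 // !exprMn.
  by rewrite exprVn -natrX.
move: (complex.Re _) (colsq x) (colsq y) (cmod t ^+ 2) (sqnorm (adj_defect g)) (sqnorm (peel _))
  => r1 r2 r3 r4 r5 r6.
nra.
Qed.

(** Bounded input-output gain. The telescoped energy balance: the readout energy is
paid out of the input energy, since the final state has nonnegative norm. *)
Lemma state_bound s k : \sum_(0 <= i < k) colsq (readout (state s i)) <=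
  2 * gain * \sum_(0 <= i < k) cmod (s i) ^+ 2.
Proof.
suff : sqnorm (state s k) + 2^-1 * \sum_(0 <= i < k) colsq (readout (state s i)) <=
    gain * \sum_(0 <= i < k) cmod (s i) ^+ 2.
  have := sqnorm_ge0 (state s k); rewrite -mulrA;
    move: (sqnorm _) (gain * _) (\sum_(_ <= _ < _) _) => a b d; lra.
elim: k => [|k IH]; first by rewrite !big_geq //= sqnorm0 !mulr0 addr0.
rewrite !big_nat_recr // mulrDr [gain * (_ + _)]mulrDr.
have := state_energy s k; move: (state s k.+1) IH => z.
set a := gain * _; set b := gain * _; set d := 2^-1 * _; set e := 2^-1 * _.
by move: a b d e => a b d e /= H1 H2; lra.
Qed.

Lemma peel_entry f j q : peel f j q 0 = f j.+1 q 0 - \sum_a iprod f (h a) * E a j.+1 q 0.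
Proof.
rewrite bshiftE ell2D ell2N ell2_sum !mxE summxE; congr (_ - _).
by apply: eq_bigr => a _; rewrite ell2Z mxE.
Qed.

(** The input attached to the coefficient (j, q): entry q of the coefficients j + 1,
j + 2, ... of E_a. As k grows this reads a fixed coefficient of the iterated
backward shifts of E_a. *)
Definition sample a j q (k : nat) : C R := E a (j + k.+1)%N q 0.

(** Unfolding T = S* - (finite rank): the correction terms are a convolution of the
readouts of v, T v, ... with the coefficients of E, that is, an output of the
driven system. *)
Lemma iter_peel_entry k j q : iter k peel (adj_defect g) j q 0 =
  adj_defect g (k + j)%N q 0 - \sum_a readout (state (sample a j q) k) a 0.
Proof.
elim: k j => [|k IH] j.
  by rewrite big1 ?subr0 // => a _; rewrite mxE iprod0l.
rewrite iterS peel_entry IH addSnnS -addrA -opprD -big_split /=.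
congr (_ - _); apply: eq_bigr => a _.
have -> : sample a j.+1 q = fun i => sample a j q i.+1.
  by apply/funext => i; rewrite /sample addSnnS.
rewrite -[peel _ + _]/(state (sample a j q) k.+1) (stateS (sample a j q) k) readoutD readoutZ.
by rewrite ![in RHS]mxE {2}/sample addn1 [readout _ a 0]mxE addrC mulrC.
Qed.

Let Cp : R := 2 ^+ size (index_enum 'I_p).

Lemma iter_peel_colsq k j : colsq (iter k peel (adj_defect g) j) <=
  2 * colsq (adj_defect g (k + j)%N) +
    2 * Cp * \sum_q \sum_a colsq (readout (state (sample a j q) k)).
Proof.
rewrite /colsq !mulr_sumr -big_split /=; apply: ler_sum => q _.
rewrite iter_peel_entry.
set x := adj_defect g _ q 0; set y := \sum_a _ a 0.
have h1 : cmod (x - y) ^+ 2 <= (cmod x + cmod y) ^+ 2.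
  by rewrite lerXn2r ?nnegrE ?addr_ge0 ?cmod_ge0 // -(cmodN y) cmodD.
apply: le_trans h1 _; apply: le_trans (sqrD_le _ _) _.
rewrite lerD2l -mulrA ler_wpM2l //.
have h2 : cmod y ^+ 2 <= (\sum_a cmod (readout (state (sample a j q) k) a 0)) ^+ 2.
  by rewrite lerXn2r ?nnegrE ?sumr_ge0 ?cmod_ge0 ?cmod_sum // => a _; rewrite cmod_ge0.
apply: le_trans h2 _; apply: le_trans (sqr_sum_le _ _) _.
rewrite ler_wpM2l ?exprn_ge0 //; apply: ler_sum => a _.
exact: colsq_entry.
Qed.

Lemma gain_ge0 : 0 <= gain.
Proof. by rewrite addr_ge0 ?sqnorm_ge0 // mulr_ge0 // colsq_ge0. Qed.

(** Tends to 0 because the backward shift does; its averages dominate those of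
|T^i v|^2. *)
Definition majorant (i : nat) : R :=
  2 * sqnorm (iter i bshift (adj_defect g)) +
    2 * Cp * (2 * gain * \sum_a sqnorm (iter i.+1 bshift (E a))).

Lemma majorant_to0 : majorant @ \oo --> (0 : R).
Proof.
apply: cvg0D; first by apply: cvg0Z; exact: iter_bshift_to0.
apply: cvg0Z; apply: cvg0Z.
rewrite -[X in _ --> X](@big1 R 0 +%R _ (index_enum 'I_p) xpredT (fun=> 0)) //.
apply: (@cvgn_sum _ _ _ (fun a i => sqnorm (iter i.+1 bshift (E a)))) => a.
have := @iter_bshift_to0 _ _ (E a); move/(cvg_comp _ _ (cvg_addnr 1)) => h1.
by apply: eq_cvgR h1 => i; rewrite /= addn1.
Qed.

(** The gain bound is applied separately to each coefficient (j, q) and each a, with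
the sum over time performed first; only then are the coefficients summed up. *)
Lemma sum_iter_peel_partial k J :
  \sum_(0 <= i < k) \sum_(0 <= j < J) colsq (iter i peel (adj_defect g) j) <= \sum_(0
    <= i < k) majorant i.
Proof.
pose X i j := \sum_q \sum_a colsq (readout (state (sample a j q) i)).
pose Y i j := \sum_q \sum_a cmod (sample a j q i) ^+ 2.
apply: (@le_trans _ _ (\sum_(0 <= i < k) (2 * sqnorm (iter i bshift (adj_defect g)) +
  2 * Cp * \sum_(0 <= j < J) X i j))).
  apply: ler_sum => i _.
  apply: (@le_trans _ _ (\sum_(0 <= j < J) (2 * colsq (adj_defect g (i + j)%N) +
    2 * Cp * X i j))).
    by apply: ler_sum => j _; exact: iter_peel_colsq.
  rewrite big_split /= -!mulr_sumr lerD2r ler_wpM2l //.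
  apply: le_trans (sqnorm_partial _ J); apply: ler_sum => j _; by rewrite iter_bshift.
rewrite !big_split /= -!mulr_sumr lerD2l ler_wpM2l ?mulr_ge0 ?exprn_ge0 //.
have step : \sum_(0 <= i < k) \sum_(0 <= j < J) X i j <=
    2 * gain * \sum_(0 <= i < k) \sum_(0 <= j < J) Y i j.
  rewrite exchange_big [in leRHS]exchange_big mulr_sumr; apply: ler_sum => j _.
  rewrite exchange_big [in leRHS]exchange_big mulr_sumr; apply: ler_sum => q _.
  rewrite exchange_big [in leRHS]exchange_big mulr_sumr; apply: ler_sum => a _.
  exact: state_bound.
apply: le_trans step _.
rewrite ler_wpM2l ?mulr_ge0 ?gain_ge0 //; apply: ler_sum => i _.
rewrite /Y (eq_bigr (fun j => \sum_a colsq (E a (i.+1 + j)%N))); last first.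
  move=> j _; rewrite exchange_big; apply: eq_bigr => a _.
  by rewrite /colsq; apply: eq_bigr => q _; rewrite /sample addnC.
rewrite exchange_big; apply: ler_sum => a _; apply: le_trans (sqnorm_partial _ J).
by apply: ler_sum => j _; rewrite -iter_bshift.
Qed.

Lemma sum_iter_peel k :
  \sum_(0 <= i < k) sqnorm (iter i peel (adj_defect g)) <= \sum_(0 <= i < k) majorant i.
Proof.
have cl : (\sum_(i <- index_iota 0 k) series (fun j =>
  colsq (iter i peel (adj_defect g) j)) J) @[J --> \oo]
    --> \sum_(0 <= i < k) sqnorm (iter i peel (adj_defect g)).
  by apply: (@cvgn_sum _ _ _ (fun i J => series (fun j =>
    colsq (iter i peel (adj_defect g) j)) J)) => i; exact: sqnorm_cvg.
by apply: (cvgr_to_le cl); apply: nearW => J; exact: sum_iter_peel_partial.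
Qed.

(** |T^k v|^2 is nonincreasing in k, so it is at most the average of the |T^i v|^2
for i <= k, which tends to 0 by Cesaro. *)
Lemma iter_peel_adj_defect_to0 : sqnorm (iter k peel (adj_defect g)) @[k --> \oo] --> (0 : R).
Proof.
have cm := cesaro majorant_to0.
apply: (cvg_to0_le _ cm) => k; rewrite sqnorm_ge0 /=.
rewrite /arithmetic_mean /= ler_pdivlMl ?ltr0n //.
apply: le_trans (sum_iter_peel k.+1).
rewrite mulr_natl -[k.+1 in leLHS]subn0 -sumr_const_nat.
apply: ler_sum_nat => i /andP[_ ik].
rewrite -(subnK (ltnSE ik)) iterD; apply: iter_peel_le.
by apply: iter_peelN; exact: adj_defectN.
Qed.

End Driven.
(** If nothing is ever read out, then T acts as the backward shift, which tends
strongly to 0, and at the same time preserves the norm. *)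
Lemma inert_eq0 f : N f -> (forall i, readout (iter i peel f) = 0) -> f = 0.
Proof.
move=> Nf f0.
have pb i : iter i peel f = iter i bshift f.
  elim: i => //= i IH; rewrite -IH /peel /strip big1 ?subr0 // => a _.
  by have := congr1 (fun x : 'cV[C R]_p => x a 0) (f0 i); rewrite !mxE => ->; rewrite scale0r.
have se i : sqnorm (iter i peel f) = sqnorm f.
  elim: i => //= i <-.
  by rewrite [RHS](energy (iter_peelN i Nf)) f0 colsq0 addr0.
apply: sqnorm_eq0; apply/esym.
apply: (cvg_unique _ (@iter_bshift_to0 _ _ f)); first exact: norm_hausdorff.
apply: (@eq_cvgR _ (fun=> sqnorm f)); last exact: cvg_cst.
by move=> i; rewrite -pb se.
Qed.

Definition stable : set (ell2 R n) :=
  [set f | N f /\ sqnorm (iter k peel f) @[k --> \oo] --> (0 : R)].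

Lemma stable_closed : closed_sub stable.
Proof.
split.
- split; first exact: closed_sub0.
  apply: (@eq_cvgR _ (fun=> 0)); last exact: cvg_cst.
  by move=> k; rewrite iter_peel0 sqnorm0.
- move=> c x y [Nx sx] [Ny sy]; split; first exact: closed_subL.
  apply: (cvg_to0_le _ (cvg0D (cvg0Z (2 * cmod c ^+ 2) sx) (cvg0Z 2 sy))) => k.
  by rewrite sqnorm_ge0 iter_peelD iter_peelZ (le_trans (sqnormD_le2 _ _)) // sqnormZ mulrA.
- move=> x l sx xl.
  have Nl : N l by apply: closed_subC xl => // k; have [] := sx k.
  split => //; apply/cvgrPdist_lt => e e0.
  have e4 : 0 < e / 4 by rewrite divr_gt0.
  have [M _ HM] := (cvgrPdist_lt _ _).1 xl _ e4.
  have [_ sM] := sx M.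
  have [K _ HK] := (cvgrPdist_lt _ _).1 sM _ e4.
  exists K => // k /= Kk.
  have := HM M (leqnn M); have := HK k Kk.
  rewrite !sub0r !normrN !ger0_norm ?sqnorm_ge0 // => h1 h2.
  have NB : N (l - x M) by apply: closed_subB => //; have [] := sx M.
  have h3 := iter_peel_le k NB.
  rewrite -(subrK (x M) l) iter_peelD; apply: le_lt_trans (sqnormD_le2 _ _) _.
  move: h1 h2 h3; rewrite (sqnormBC l).
  move: (sqnorm _) (sqnorm _) (sqnorm _) => a b d; lra.
Qed.

Lemma stable_adj_defect g : N g -> stable (adj_defect g).
Proof. by move=> Ng; split; [exact: adj_defectN|exact: iter_peel_adj_defect_to0]. Qed.

Lemma stable_peel f : N f -> stable (peel f) -> stable f.
Proof.
move=> Nf [_ /cvgrPdist_lt H]; split => //; apply/cvgrPdist_lt => e e0.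
have [K _ HK] := H e e0; exists K.+1 => // -[|k] //= Kk.
by rewrite -iterS iterSr; exact: HK.
Qed.

(** T T* g = g - (g - T T* g) is stable, and f is stable as soon as T f is. *)
Lemma stable_peel_adj g : stable g -> stable (peel_adj g).
Proof.
move=> sg; have [Ng _] := sg; apply: stable_peel; first exact: peel_adjN.
rewrite -(subKr g (peel _)); apply: (closed_subB stable_closed) => //.
exact: stable_adj_defect.
Qed.

Lemma iter_peel_adjP i f g : N f -> iprod f (iter i peel_adj g) = iprod (iter i peel f) g.
Proof.
elim: i f => //= i IH f Nf.
by rewrite -peel_adjP // IH; [rewrite -iterSr|exact: peelN].
Qed.

(** Let x = T^i (f - q), where q is the projection of f on the stable vectors. Then
T*^i (x - T*T x) is stable, hence orthogonal to f - q; this inner product is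
the squared norm of the readout of x. So f - q is inert, hence 0. *)
Theorem iter_peel_to0 f : N f -> sqnorm (iter k peel f) @[k --> \oo] --> (0 : R).
Proof.
move=> Nf; suff [] : stable f by [].
have [sp fp] := orth_projP stable_closed f.
set q := orth_proj stable f in sp fp.
have Nq : N (f - q) by apply: closed_subB => //; case: sp.
suff -> : f = q by [].
apply/subr0_eq/inert_eq0 => // i.
set x := iter i peel (f - q).
have Nx : N x by exact: iter_peelN.
(* with y = T x, the image of this vector under T is the vector y - T T* y *)
have sx : stable (x - peel_adj (peel x)).
  have NTx := peelN Nx.
  apply: stable_peel; first by apply: closed_subB => //; exact: peel_adjN.
  rewrite peelD -scaleN1r peelZ scaleN1r; exact: stable_adj_defect.
have si : stable (iter i peel_adj (x - peel_adj (peel x))).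
  by elim: (i) => //= k; exact: stable_peel_adj.
have := fp _ si; rewrite iter_peel_adjP // -/x iprodBr -peel_adjP // (polarized Nx Nx).
rewrite addrC addKr coldotv => h0.
by apply: colsq_eq0; apply: cplx_inj.
Qed.

(** Taylor coefficients of the vector k with F = E k. *)
Definition symbol f (k : nat) : 'cV[C R]_p := readout (iter k peel f).

Lemma symbol_partial f k : N f ->
  \sum_(0 <= i < k) colsq (symbol f i) = sqnorm f - sqnorm (iter k peel f).
Proof.
move=> Nf; elim: k => [|k IH]; first by rewrite big_geq //= subrr.
rewrite big_nat_recr //= IH (energy (iter_peelN k Nf)) -/(symbol f k) opprD addrA.
by rewrite subrK.
Qed.

Lemma symbol_sqsum f : N f -> sqsum (symbol f).
Proof.
move=> Nf; apply: (@sqsum_bounded _ _ _ (sqnorm f)) => k.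
by rewrite symbol_partial // gerBl sqnorm_ge0.
Qed.

Definition is_symbol f (k : ell2 R p) := N f /\ forall i, k i = symbol f i.

Lemma is_symbol_ex f : N f -> exists k, is_symbol f k.
Proof. by move=> Nf; exists (mk_ell2 (symbol_sqsum Nf)). Qed.

(** The energy identity telescopes, and the remainder |T^k f|^2 tends to 0. *)
Lemma is_symbol_isometry f k : is_symbol f k -> sqnorm k = sqnorm f.
Proof.
move=> [Nf kf]; apply: (cvg_unique _ (@sqnorm_cvg _ _ k)); first exact: norm_hausdorff.
have cvh : (sqnorm f - sqnorm (iter i peel f)) @[i --> \oo] --> sqnorm f - 0.
  by apply: cvgB; [exact: cvg_cst|exact: iter_peel_to0].
rewrite subr0 in cvh; apply: eq_cvgR cvh => i.
by rewrite -symbol_partial //; apply: eq_bigr => j _; rewrite kf.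
Qed.

Lemma is_symbolL c f g k l : is_symbol f k -> is_symbol g l ->
  is_symbol (c *: f + g) (c *: k + l).
Proof.
move=> [Nf kf] [Ng lg]; split; first exact: closed_subL.
by move=> i; rewrite ell2D ell2Z kf lg /symbol iter_peelD iter_peelZ readoutD readoutZ.
Qed.

Lemma is_symbolB f g k l : is_symbol f k -> is_symbol g l -> is_symbol (f - g) (k - l).
Proof.
move=> h1 h2; rewrite (addrC f) (addrC k) -(scaleN1r g) -(scaleN1r l).
exact: is_symbolL.
Qed.

Lemma is_symbol_peel f k : is_symbol f k -> is_symbol (peel f) (bshift k).
Proof.
move=> [Nf kf]; split; first exact: peelN.
by move=> i; rewrite bshiftE kf /symbol iterSr.
Qed.

Definition symbols : set (ell2 R p) := [set k | exists f, is_symbol f k].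

Lemma cvg_ell2_unique m (x : nat -> ell2 R m) l l' : cvg_ell2 x l -> cvg_ell2 x l' -> l = l'.
Proof.
move=> xl xl'; apply: ell2_eq => i; apply/matrixP => q j; rewrite (ord1 j).
apply: (@cvgC_unique _ (fun t => x t i q 0)); exact: cvg_ell2_coef.
Qed.

(** The symbol map is isometric: a convergent sequence of symbols comes from a
Cauchy sequence in N, and the limits correspond. *)
Lemma symbols_closed : closed_sub symbols.
Proof.
split.
- exists 0; split; first exact: closed_sub0.
  by move=> i; rewrite /symbol iter_peel0 readout0.
- by move=> c k l [f kf] [g lg]; exists (c *: f + g); apply: is_symbolL.
- move=> k l kS kl.
  pose f i := projT1 (cid (kS i)).
  have kf i : is_symbol (f i) (k i) := projT2 (cid (kS i)).
  have [f0 ff0] : exists f0, cvg_ell2 f f0.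
    apply: ell2_complete => e e0.
    have e4 : 0 < e / 4 by rewrite divr_gt0.
    have [M _ HM] := (cvgrPdist_lt _ _).1 kl _ e4.
    have kM i : (M <= i)%N -> sqnorm (k i - l) < e / 4.
      by move=> /HM; rewrite sub0r normrN ger0_norm // sqnorm_ge0.
    exists M => i j /kM ki /kM kj.
    rewrite -(is_symbol_isometry (is_symbolB (kf i) (kf j))).
    have -> : k i - k j = (k i - l) - (k j - l).
      by rewrite opprB addrA subrK.
    apply: le_trans (sqnormB_le2 _ _) _.
    move: ki kj; move: (sqnorm (k i - l)) (sqnorm (k j - l)) => a b; lra.
  have Nf0 : N f0 by apply: closed_subC ff0 => // i; have [] := kf i.
  have [k0 k0f] := is_symbol_ex Nf0.
  exists f0; suff -> : l = k0 by [].
  apply: (cvg_ell2_unique kl); apply: eq_cvgR ff0 => i.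
  by rewrite (is_symbol_isometry (is_symbolB (kf i) k0f)).
Qed.

End Stability.

(** * Square-summable sequences as functions on the disc *)

Section Realization.
Variables (R : realType).

Lemma cvgC_sum (I : Type) (r : seq I) (F : I -> nat -> C R) (l : I -> C R) :
  (forall i, F i @ \oo --> l i) -> (\sum_(i <- r) F i k) @[k --> \oo] --> \sum_(i <- r) l i.
Proof.
move=> H; elim: r => [|i r IH].
  by rewrite big_nil (_ : (fun k => _) = fun=> 0); [exact: cvg_cst|apply/funext => k;
    rewrite big_nil].
rewrite big_cons.
have h := @cvgCD _ (F i) (fun k => \sum_(j <- r) F j k) _ _ (H i) IH.
by apply: eq_cvgC h => k; rewrite big_cons.
Qed.

Variable n : nat.
Implicit Types (a b : ell2 R n) (z : disc R).

Definition coef a (q : 'I_n) : nat -> C R := fun k => a k q 0.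

Lemma coef_square_summable a q : square_summable (coef a q).
Proof.
apply: (@series_summable_le _ (fun k => cmod (coef a q k) ^+ 2) (fun k => colsq (a k)));
  last exact: ell2_sqsum.
by move=> k; rewrite exprn_ge0 ?cmod_ge0 //= colsq_entry.
Qed.

Definition realize a : vfun R n := fun z => \col_q powfun (coef a q) z.

Lemma realize_taylor a q : has_taylor (entry (realize a) q) (coef a q).
Proof.
have -> : entry (realize a) q = powfun (coef a q) by apply/funext => z; rewrite /entry mxE.
by apply: powfun_taylor; exact: coef_square_summable.
Qed.

Lemma taylor_realize a q : taylor (entry (realize a) q) = coef a q.
Proof. exact: taylorE (@realize_taylor a q). Qed.

Lemma realizeP a (F : vfun R n) : (forall q, has_taylor (entry F q) (coef a q)) -> F = realize a.
Proof.
move=> H; apply/funext => z; apply/matrixP => q j; rewrite (ord1 j).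
exact: cvgC_unique (H q z) (@realize_taylor a q z).
Qed.

Lemma H2_realize a : H2 R n (realize a).
Proof. by move=> q; exists (coef a q); [exact: realize_taylor|exact: coef_square_summable]. Qed.

Lemma H2P (F : vfun R n) : H2 R n F -> exists a, F = realize a.
Proof.
move=> HF.
pose f k : 'cV[C R]_n := \col_q taylor (entry F q) k.
have tF q : has_taylor (entry F q) (fun k => f k q 0) /\ square_summable (fun k => f k q 0).
  have [c hc sc] := HF q.
  rewrite (_ : (fun k => f k q 0) = c) //.
  by apply/funext => k; rewrite mxE (taylorE hc).
have sf : sqsum f.
  apply: (@sqsum_bounded _ _ _ (\sum_q limn (series (fun k => cmod (f k q 0) ^+ 2)))) => N.
  rewrite exchange_big; apply: ler_sum => q _.
  apply: (@series_le_lim _ (fun k => cmod (f k q 0) ^+ 2)) => [k|];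
    first by rewrite exprn_ge0 ?cmod_ge0.
  by have [] := tF q.
by exists (mk_ell2 sf); apply: realizeP => q; have [] := tF q.
Qed.

Lemma realize_inj : injective realize.
Proof.
move=> a b ab; apply: ell2_eq => k; apply/matrixP => q j; rewrite (ord1 j).
by have := taylor_realize a q; rewrite ab taylor_realize => /(congr1 (fun c => c k)).
Qed.

Lemma realizeL (c : C R) a b : realize (c *: a + b) = c *: realize a + realize b.
Proof.
apply/esym/realizeP => q z.
have h : (c * series (fun k => coef a q k * val z ^+ k) N + series (fun k =>
  coef b q k * val z ^+ k) N)
   @[N --> \oo] --> c * entry (realize a) q z + entry (realize b) q z.
  apply: cvgCD; last exact: realize_taylor.
  by apply: cvgCZ; exact: realize_taylor.
have -> : entry (c *: realize a + realize b) q z = c * entry (realize a) q z +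
  entry (realize b) q z.
  rewrite /entry; change ((c *: realize a z + realize b z) q 0 = c * realize a z q 0 +
    realize b z q 0).
  by move: (realize a z) (realize b z) => u v; rewrite !mxE.
apply: eq_cvgC h => N; rewrite /series /= mulr_sumr -big_split /=.
by apply: eq_bigr => k _; rewrite /coef ell2D ell2Z !mxE mulrA mulrDl.
Qed.

Lemma realize0 : realize 0 = 0.
Proof. by have := realizeL (-1) 0 0; rewrite addr0 scaler0 scaleN1r addNr. Qed.
Lemma realizeD a b : realize (a + b) = realize a + realize b.
Proof. by rewrite -[a]scale1r realizeL !scale1r. Qed.
Lemma realizeZ c a : realize (c *: a) = c *: realize a.
Proof. by rewrite -[c *: a]addr0 realizeL realize0 addr0. Qed.
Lemma realizeB a b : realize (a - b) = realize a - realize b.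
Proof. by rewrite realizeD -scaleN1r realizeZ scaleN1r. Qed.
Lemma realize_sum I (r : seq I) (P : pred I) (G : I -> ell2 R n) :
  realize (\sum_(i <- r | P i) G i) = \sum_(i <- r | P i) realize (G i).
Proof. by elim/big_rec2: _ => [|i x y _ <-]; [exact: realize0|exact: realizeD]. Qed.
Lemma vfun_sumE I (r : seq I) (P : pred I) (G : I -> vfun R n) z :
  (\sum_(i <- r | P i) G i) z = \sum_(i <- r | P i) G i z.
Proof. by elim/big_rec2: _ => // i x y _ <-. Qed.

Lemma normsq_realize a : normsq (realize a) = sqnorm a.
Proof.
apply: cvg_unique (@sqnorm_cvg _ _ a); first exact: norm_hausdorff.
rewrite /normsq.
have h : (\sum_q series (fun k =>
  cmod (coef a q k) ^+ 2) N) @[N --> \oo] --> \sum_q hardy_normsq (entry (realize a) q).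
  apply: (@cvgn_sum _ _ _ (fun q N => series (fun k => cmod (coef a q k) ^+ 2) N)) => q.
  by rewrite /hardy_normsq taylor_realize; exact: coef_square_summable.
by apply: eq_cvgR h => N; rewrite /series /= exchange_big.
Qed.

Lemma inner_realize a b : inner (realize a) (realize b) = iprod a b.
Proof.
apply: cvgC_unique (@iprod_cvg _ _ a b).
rewrite /inner.
have h : (\sum_q series (fun k => coef a q k * (coef b q k)^*) N) @[N --> \oo]
    --> \sum_q hardy_inner (entry (realize a) q) (entry (realize b) q).
  apply: (@cvgC_sum _ _ (fun q N => series (fun k => coef a q k * (coef b q k)^*) N)) => q.
  rewrite /hardy_inner !taylor_realize; apply: (@abs_summableC _ (fun k =>
    coef a q k * (coef b q k)^*)).
  have cs : cvgn (series ((fun k => cmod (coef a q k) ^+ 2) + (fun k => cmod (coef b q k) ^+ 2))).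
    by apply: is_cvg_seriesD; exact: coef_square_summable.
  by apply: series_summable_le cs => k; rewrite cmod_ge0 /= cmodM cmod_conj mul_le_sqr.
by apply: eq_cvgC h => N; rewrite /series /= exchange_big.
Qed.

Lemma realize_split a z : realize a z = a 0%N + val z *: realize (bshift a) z.
Proof.
apply/matrixP => q j; rewrite (ord1 j).
have -> : (a 0%N + val z *: realize (bshift a) z) q 0 = coef a q 0 +
  val z * entry (realize (bshift a)) q z.
  by rewrite /entry /coef; move: (realize _ z) => u; rewrite !mxE.
rewrite -/(entry (realize a) q z).
have h : (coef a q 0 + val z * series (fun k => coef (bshift a) q k * val z ^+ k) N) @[N --> \oo]
    --> coef a q 0 + val z * entry (realize (bshift a)) q z.
  apply: cvgCD; first exact: cvg_cst.
  by apply: cvgCZ; exact: realize_taylor.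
have := @realize_taylor a q z; move/(cvg_comp _ _ (cvg_addnr 1)) => h1.
apply: cvgC_unique h1 _; apply: eq_cvgC h => N.
rewrite /series /= addn1 big_nat_recl //= expr0 mulr1 mulr_sumr; congr (_ + _).
by apply: eq_bigr => k _; rewrite exprS mulrCA.
Qed.

Lemma realize_at0 a z : val z = 0 -> realize a z = a 0%N.
Proof. by move=> z0; rewrite realize_split z0 scale0r addr0. Qed.

Lemma realize_fshift a z : realize (fshift a) z = val z *: realize a z.
Proof. by rewrite realize_split fshift0 add0r bshift_fshift. Qed.

Lemma backshift_realize a : backshift (realize a) = realize (bshift a).
Proof.
apply/funext => z; apply/matrixP => q j; rewrite (ord1 j) /backshift mxE /hardy_backshift.
have [z0|z0] := eqVneq (val z) 0; first by rewrite taylor_realize (realize_at0 _ z0).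
rewrite /entry (realize_at0 a (erefl (val (disc0 R)))).
have -> : realize a z q 0 = a 0%N q 0 + val z * realize (bshift a) z q 0.
  by rewrite realize_split; move: (realize _ z) => u; rewrite !mxE.
by rewrite addrC addKr mulrC mulKf.
Qed.

Lemma zH2_realize a : zH2 R n (realize a) <-> a 0%N = 0.
Proof.
split.
  move=> [G _ /(_ (disc0 R))]; rewrite (realize_at0 a (erefl (val (disc0 R)))) => ->.
  by rewrite scale0r.
move=> a0; exists (realize (bshift a)); first exact: H2_realize.
by move=> z; rewrite realize_split a0 add0r.
Qed.

(** Any bound uniform on norm-bounded sets will do; this one needs no square roots. *)
Lemma realize_bound z : exists B : R, forall a q, cmod (realize a z q 0) <= sqnorm a + B.
Proof.
pose r := cmod (val z).
have r0 : 0 <= r := cmod_ge0 _.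
have r1 : r < 1 := disc_cmod z.
have g0 k : 0 <= geometric 1 (r ^+ 2) k by rewrite /geometric /= mul1r exprn_ge0 // exprn_ge0.
have cg : cvgn (series (geometric 1 (r ^+ 2))).
  by apply: is_cvg_geometric_series; rewrite ger0_norm ?exprn_ge0 // exprn_ilt1.
exists (limn (series (geometric 1 (r ^+ 2)))) => a q.
have h := @cvgC_cmodB _ _ _ 0 (@realize_taylor a q z); rewrite /entry in h.
rewrite -cmodN -sub0r; apply: (cvgr_to_le h); apply: nearW => N.
rewrite sub0r cmodN; apply: le_trans (cmod_sum _ _ _) _.
apply: (@le_trans _ _ (\sum_(0 <= k < N) (colsq (a k) + geometric 1 (r ^+ 2) k))).
  apply: ler_sum => k _; rewrite cmodM cmodX -/r.
  apply: le_trans (mul_le_sqr _ _) _; rewrite /geometric /= mul1r -!exprM mulnC lerD2r.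
  exact: colsq_entry.
rewrite big_split /= lerD ?sqnorm_partial //.
exact: (@series_le_lim _ _ N g0 cg).
Qed.

End Realization.

Arguments realize {R n} a _.

Lemma scale_entry (R : realType) n (c : C R) (v : 'cV[C R]_n) q : (c *: v) q 0 = c * v q 0.
Proof. by rewrite mxE. Qed.

(** * The factorization F = E k on the disc *)

Section Factorization.
Variables (R : realType) (n p : nat) (N : set (ell2 R n)) (cN : closed_sub N).
Variables (E h : 'I_p -> ell2 R n).
Hypothesis Nh : forall a, N (h a).
Hypothesis peelN : forall f, N f -> N (peel E h f).
Hypothesis energy : forall f, N f -> sqnorm f = sqnorm (peel E h f) + colsq (readout h f).
Hypothesis strip0 : forall f, N f -> strip E h f 0%N = 0.
Implicit Types (f : ell2 R n) (z : disc R).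

Lemma realize_peel f z : N f ->
  realize f z = \sum_a readout h f a 0 *: realize (E a) z + val z *: realize (peel E h f) z.
Proof.
move=> Nf; rewrite -realize_fshift fshift_bshift ?strip0 // -[in LHS](subrK (\sum_a iprod f (h
  a) *: E a) f).
rewrite addrC realizeD realize_sum -[LHS]/((\sum_a realize (iprod f (h a) *: E a)) z +
  realize (strip E h f) z).
rewrite vfun_sumE; congr (_ + _); apply: eq_bigr => a _.
by rewrite realizeZ mxE.
Qed.

Lemma realize_iter_peel f k N1 z : is_symbol N E h f k -> realize f z =
  \sum_a series (fun i => coef k a i * val z ^+ i) N1 *: realize (E a) z
  + val z ^+ N1 *: realize (iter N1 (peel E h) f) z.
Proof.
move=> [Nf kf]; elim: N1 => [|N1 IH].
  by rewrite big1 ?add0r ?expr0 ?scale1r // => a _; rewrite /series /= big_geq // scale0r.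
rewrite IH (realize_peel z (iter_peelN peelN N1 Nf)) scalerDr addrA scalerA -exprSr.
congr (_ + _); rewrite scaler_sumr -big_split /=; apply: eq_bigr => a _.
rewrite scalerA -scalerDl; congr (_ *: _).
by rewrite seriesSr /coef kf /symbol mulrC.
Qed.

(** The remainder z^N T^N f tends to 0 at every point of the disc, because the norms
|T^N f| are bounded and |z| < 1. *)
Theorem realize_symbol f k z : is_symbol N E h f k ->
  realize f z = \sum_a realize k z a 0 *: realize (E a) z.
Proof.
move=> kf; have [Nf _] := kf.
apply/matrixP => q j; rewrite (ord1 j) summxE.
pose u N1 := \sum_a series (fun i => coef k a i * val z ^+ i) N1 * realize (E a) z q 0.
have uk : u @ \oo --> \sum_a (realize k z a 0 *: realize (E a) z) q 0.
  apply: (@cvgC_sum _ _ _ (fun a N1 => series (fun i =>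
    coef k a i * val z ^+ i) N1 * realize (E a) z q 0)) => a.
  rewrite scale_entry; apply: (@eq_cvgC _ (fun N1 => realize (E a) z q 0 * series (fun i =>
    coef k a i * val z ^+ i) N1)).
    by move=> N1; rewrite mulrC.
  by rewrite mulrC; apply: cvgCZ; exact: (@realize_taylor _ _ k a z).
apply: cvgC_unique uk; apply/cvgC_cmod.
have [B HB] := realize_bound n z.
have r1 : `|cmod (val z)| < 1 by rewrite ger0_norm ?cmod_ge0 // disc_cmod.
apply: (cvg_to0_le _ (cvg0Z (sqnorm f + B) (cvg_expr r1))) => N1.
rewrite cmod_ge0 /= cmodB.
have -> : realize f z q 0 - u N1 = val z ^+ N1 * realize (iter N1 (peel E h) f) z q 0.
  rewrite (realize_iter_peel N1 z kf) mxE summxE (scale_entry (val z ^+ N1)) /u.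
  rewrite (eq_bigr (fun a => series (fun i => coef k a i * val z ^+ i) N1 * realize (E a) z q 0)).
    by rewrite addrC addrK.
  by move=> a _; exact: scale_entry.
rewrite cmodM cmodX mulrC ler_wpM2r ?exprn_ge0 ?cmod_ge0 //.
apply: le_trans (HB _ _) _; rewrite lerD2r.
by apply: (@iter_peel_le _ _ _ N).
Qed.

End Factorization.

Section Bridge.
Variables (R : realType) (n : nat).
Implicit Types (M : set (vfun R n)) (K : set (ell2 R n)).

Lemma closed_sub_coefs M : closed_subspace M -> closed_sub [set a | M (realize a)].
Proof.
move=> [MH [M0 ML] MC]; split => /=.
- by rewrite realize0.
- by move=> c x y Mx My; rewrite realizeL; exact: ML.
- move=> x l Mx xl; apply: (MC _ (realize l) Mx); first exact: H2_realize.
  by apply: eq_cvgR xl => k; rewrite -realizeB normsq_realize.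
Qed.

Lemma closed_subspace_image K : closed_sub K -> closed_subspace (realize @` K).
Proof.
move=> cK; split.
- by move=> _ [a _ <-]; exact: H2_realize.
- split; first by exists 0; [exact: closed_sub0|exact: realize0].
  move=> c _ _ [a Ka <-] [b Kb <-]; exists (c *: a + b); last exact: realizeL.
  exact: closed_subL.
- move=> F_ F KF /H2P [l ->] Fl.
  pose a k := s2val (cid2 (KF k)).
  have Ka k : K (a k) := s2valP (cid2 (KF k)).
  have Fa k : realize (a k) = F_ k := s2valP' (cid2 (KF k)).
  exists l => //; apply: (closed_subC cK Ka).
  by apply: eq_cvgR Fl => k; rewrite -Fa -realizeB normsq_realize.
Qed.

Lemma backshift_invariant_image K : (forall a, K a -> K (bshift a)) ->
  backshift_invariant (realize @` K).
Proof.
by move=> KB _ [a Ka <-]; exists (bshift a); [exact: KB|rewrite backshift_realize].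
Qed.

End Bridge.

(** * The wandering subspace *)

Section FiniteDimension.
Variables (R : realType) (n : nat).

Lemma mulmx_sum_col r (A : 'M[C R]_(n, r)) (v : 'cV[C R]_r) : A *m v = \sum_i v i 0 *: col i A.
Proof.
apply/matrixP => q j; rewrite (ord1 j) !mxE summxE; apply: eq_bigr => i _.
by rewrite !mxE mulrC.
Qed.

Lemma subspace_comb (W : set (vfun R n)) r (b : 'I_r -> vfun R n) (c : 'I_r -> C R) :
  linear_subspace W -> (forall i, W (b i)) -> W (\sum_i c i *: b i).
Proof.
move=> [W0 WL] Wb; elim/big_ind: _ => [//|x y Wx Wy|i _].
  by rewrite -[x]scale1r; exact: WL.
by rewrite -[_ *: _]addr0; exact: WL.
Qed.

(** Evaluation at 0 embeds W in C^n, so independent families of W have at most n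
elements, and one of maximal length spans W. *)
Lemma has_dim_eval_injective (W : set (vfun R n)) : linear_subspace W ->
  (forall F, W F -> F (disc0 R) = 0 -> F = 0) -> exists r, has_dim W r.
Proof.
move=> WL Winj.
pose P r := `[< exists b : 'I_r -> vfun R n, lin_indep b /\ forall i, W (b i) >].
have P0 : exists r, P r.
  by exists 0%N; apply/asboolP; exists (fun=> 0); split; [move=> c _ []|case].
have Pn r : P r -> (r <= n)%N.
  move=> /asboolP[b [bi Wb]].
  pose B : 'M[C R]_(r, n) := \matrix_(i, q) b i (disc0 R) q 0.
  suff /eqP <- : row_free B by exact: rank_leq_col.
  apply: inj_row_free => v vB; apply/matrixP => j i; rewrite (ord1 j) mxE.
  apply: (bi (v 0)); apply: Winj; first exact: subspace_comb.
  rewrite vfun_sumE; apply/matrixP => q k; rewrite (ord1 k) summxE [RHS]mxE.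
  transitivity ((v *m B) 0 q); last by rewrite vB mxE.
  by rewrite [RHS]mxE; apply: eq_bigr => l _; rewrite [B _ _]mxE; exact: scale_entry.
case: (ex_maxnP P0 Pn) => r /asboolP[b [bi Wb]] rmax.
exists r, b; split => //; apply/seteqP; split; last first.
  by move=> _ [c ->]; exact: subspace_comb.
move=> F WF; apply: contrapT => nF.
suff /rmax : P r.+1 by rewrite ltnn.
apply/asboolP; exists (fun i => if unlift ord_max i is Some j then b j else F).
split; last by move=> i; case: unliftP => [j|] _.
move=> c; rewrite big_ord_recr /= unlift_none.
rewrite (eq_bigr (fun i => c (widen_ord (leqnSn r) i) *: b i)); last first.
  move=> i _; have -> : widen_ord (leqnSn r) i = lift ord_max i.
    by apply: val_inj; rewrite /= /bump leqNgt ltn_ord.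
  by rewrite liftK.
move=> s0.
have cF : c ord_max = 0.
  apply/eqP/negPn/negP => c0; apply: nF.
  exists (fun i => - (c ord_max)^-1 * c (widen_ord (leqnSn r) i)).
  rewrite (eq_bigr (fun i => - (c ord_max)^-1 *: (c (widen_ord (leqnSn r) i) *: b i)));
    last first.
    by move=> i _; rewrite scalerA.
  rewrite -scaler_sumr; move/eqP: s0; rewrite addr_eq0 => /eqP ->.
  by rewrite scalerN scaleNr opprK scalerA mulVf // scale1r.
rewrite cF scale0r addr0 in s0; have ci := bi _ s0.
move=> i; case: (unliftP ord_max i) => [j|] -> //.
have -> : lift ord_max j = widen_ord (leqnSn r) j.
  by apply: val_inj; rewrite /= /bump leqNgt ltn_ord.
exact: ci.
Qed.

End FiniteDimension.

Section Wandering.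
Variables (R : realType) (n : nat).
Implicit Types (M : set (vfun R n)) (F G : vfun R n).

Lemma inner_eq0 F : H2 R n F -> inner F F = 0 -> F = 0.
Proof.
by move=> /H2P[a ->]; rewrite inner_realize iprod_sqnorm => /cplx_inj/sqnorm_eq0 ->;
  rewrite realize0.
Qed.

Lemma zH2P F : H2 R n F -> (zH2 R n F <-> F (disc0 R) = 0).
Proof. by move=> /H2P[a ->]; rewrite zH2_realize realize_at0. Qed.

Section Subspace.
Variables (M : set (vfun R n)) (cM : closed_subspace M).
Let W := ominus M (M `&` zH2 R n).

(** An element of W vanishing at 0 lies in the subspace to which W is orthogonal. *)
Lemma wandering_eval_injective F : W F -> F (disc0 R) = 0 -> F = 0.
Proof.
move=> [MF oF] F0; have [MH _ _] := cM; apply: inner_eq0; first exact: MH.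
by apply: oF; split => //; apply/zH2P => //; exact: MH.
Qed.

Lemma wandering_subspace : linear_subspace W.
Proof.
have [MH [M0 ML] _] := cM; split.
  split => // G [/MH/H2P[g ->] _].
  by rewrite -realize0 inner_realize iprod0l.
move=> c F G [MF oF] [MG oG]; split; first exact: ML.
move=> K [MK zK]; have := oF K (conj MK zK); have := oG K (conj MK zK).
have [f ->] := H2P (MH _ MF); have [g ->] := H2P (MH _ MG); have [k ->] := H2P (MH _ MK).
by rewrite -realizeL !inner_realize iprodDl iprodZl => -> ->; rewrite mulr0 addr0.
Qed.

Lemma wandering_has_dim : exists r, has_dim W r.
Proof. exact: has_dim_eval_injective wandering_subspace wandering_eval_injective. Qed.

Lemma wandering_vanishing : (forall F, M F -> F (disc0 R) = 0) -> W = [set 0].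
Proof.
move=> MV; apply/seteqP; split => F; last by move=> ->; case: wandering_subspace.
by move=> WF; apply: wandering_eval_injective => //; apply: MV; case: WF.
Qed.

End Subspace.

Lemma span_mem m (b : 'I_m -> vfun R n) i : Defs.span b (b i).
Proof.
exists (fun j => (j == i)%:R); rewrite (bigD1 i) //= eqxx scale1r big1 ?addr0 // => j /negbTE ->.
by rewrite scale0r.
Qed.

Lemma orthonormal_coefs m (e : 'I_m -> vfun R n) D : orthonormal_basis e D -> D `<=` H2 R n ->
  exists ee : 'I_m -> ell2 R n, (forall j, e j = realize (ee j)) /\
    forall i j, iprod (ee i) (ee j) = (i == j)%:R.
Proof.
move=> [oe De] DH.
have H j : exists a, e j = realize a by apply/H2P/DH; rewrite De; exact: span_mem.
exists (fun j => projT1 (cid (H j))).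
have He j : e j = realize (projT1 (cid (H j))) := projT2 (cid (H j)).
by split => // i j; rewrite -inner_realize -!He.
Qed.

Lemma iprod_orthonormal m (v : 'I_m -> ell2 R n) (c : 'I_m -> C R) j :
  (forall i j, iprod (v i) (v j) = (i == j)%:R) -> iprod (\sum_i c i *: v i) (v j) = c j.
Proof.
move=> ov; rewrite iprod_suml (bigD1 j) //= iprodZl ov eqxx mulr1 big1 ?addr0 // => i /negbTE ij.
by rewrite iprodZl ov ij mulr0.
Qed.

Lemma sqnorm_orthonormal m (v : 'I_m -> ell2 R n) (c : 'I_m -> C R) :
  (forall i j, iprod (v i) (v j) = (i == j)%:R) ->
  sqnorm (\sum_i c i *: v i) = \sum_i cmod (c i) ^+ 2.
Proof.
move=> ov; apply: cplx_inj; rewrite -iprod_sqnorm iprod_sumr cplx_sum; apply: eq_bigr => i _.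
by rewrite iprodZr iprod_orthonormal // mulrC cmod_mulC.
Qed.

End Wandering.

(** * Peeling for a nearly invariant subspace *)

Section Model.
Variables (R : realType) (n m r : nat).
Variables (N : set (ell2 R n)) (cN : closed_sub N).

(** The coefficient form of the intersection of M with z H2. *)
Definition vanishing : set (ell2 R n) := [set a | N a /\ a 0%N = 0].

Lemma vanishing_closed : closed_sub vanishing.
Proof.
split.
- by split; [exact: closed_sub0|].
- move=> c x y [Nx x0] [Ny y0]; split; first exact: closed_subL.
  by rewrite ell2D ell2Z x0 y0 scaler0 addr0.
- move=> x l Vx xl; split; first by apply: closed_subC xl => // k; have [] := Vx k.
  apply/matrixP => q j; rewrite (ord1 j) [RHS]mxE.
  apply: (@cvgC_unique _ (fun k => x k 0%N q 0)); first exact: cvg_ell2_coef.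
  apply: (@eq_cvgC _ (fun=> 0)); last exact: cvg_cst.
  by move=> k; have [_ ->] := Vx k; rewrite mxE.
Qed.

Let P0 : ell2 R n -> ell2 R n := orth_proj vanishing.

Lemma iprod_proj_vanishing f x : iprod f (P0 x) = iprod (P0 f) x.
Proof.
have V y : vanishing (P0 y) by exact: orth_proj_in vanishing_closed y.
by rewrite -(orth_proj_iprod vanishing_closed f (V x)) [RHS]iprodC -(orth_proj_iprod
  vanishing_closed x (V f)) -iprodC.
Qed.

Variables (ff : 'I_r -> ell2 R n) (ee : 'I_m -> ell2 R n).
Hypothesis ffO : forall i j, iprod (ff i) (ff j) = (i == j)%:R.
Hypothesis ffN : forall i, N (ff i).
Hypothesis ffV : forall i g, vanishing g -> iprod (ff i) g = 0.
Hypothesis ffW : forall f, N f -> exists c : 'I_r -> C R, f - P0 f = \sum_i c i *: ff i.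
Hypothesis eeO : forall i j, iprod (ee i) (ee j) = (i == j)%:R.
Hypothesis eeN : forall j g, N g -> iprod (ee j) g = 0.
Hypothesis eeD : forall g, vanishing g ->
  exists (g1 : ell2 R n) (d : 'I_m -> C R), N g1 /\ bshift g = g1 + \sum_j d j *: ee j.

(** The entries of E = (F0, z e_1, ..., z e_m). *)
Definition multipliers (a : 'I_(r + m)) : ell2 R n :=
  match fintype.split a with inl i => ff i | inr j => fshift (ee j) end.
(** The vectors representing the data (c, d) as inner products: d_j is
<S* P0 f, e_j> = <P0 f, z e_j> = <f, P0 (z e_j)>. *)
Definition functionals (a : 'I_(r + m)) : ell2 R n :=
  match fintype.split a with inl i => ff i | inr j => P0 (fshift (ee j)) end.

Lemma multipliersl i : multipliers (lshift m i) = ff i.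
Proof. by rewrite /multipliers (unsplitK (inl i)). Qed.
Lemma multipliersr j : multipliers (rshift r j) = fshift (ee j).
Proof. by rewrite /multipliers (unsplitK (inr j)). Qed.
Lemma functionalsl i : functionals (lshift m i) = ff i.
Proof. by rewrite /functionals (unsplitK (inl i)). Qed.
Lemma functionalsr j : functionals (rshift r j) = P0 (fshift (ee j)).
Proof. by rewrite /functionals (unsplitK (inr j)). Qed.

Lemma functionalsN a : N (functionals a).
Proof.
rewrite /functionals; case: (fintype.split a) => [i|j]; first exact: ffN.
by have [] := orth_proj_in vanishing_closed (fshift (ee j)).
Qed.

(** The component of f along W is computed from f itself, as P0 f is orthogonal to W. *)
Lemma wandering_decomposition f : N f -> f = P0 f + \sum_i iprod f (ff i) *: ff i.
Proof.
move=> Nf; have [c fc] := ffW Nf.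
have cE i : c i = iprod f (ff i).
  rewrite -(iprod_orthonormal c i ffO) -fc iprodBl (iprodC (ff i) (P0 f)).
  by rewrite ffV ?conjC0 ?subr0 //; exact: orth_proj_in vanishing_closed f.
rewrite -[LHS](subrK (P0 f)) fc addrC; congr (_ + _).
by apply: eq_bigr => i _; rewrite cE.
Qed.

Lemma strip_model f : N f -> strip multipliers functionals f =
  P0 f - \sum_j iprod (P0 f) (fshift (ee j)) *: fshift (ee j).
Proof.
move=> Nf; rewrite /strip big_split_ord /= opprD addrA.
under eq_bigr => i _ do rewrite functionalsl multipliersl.
under [X in _ - X]eq_bigr => j _ do rewrite functionalsr multipliersr iprod_proj_vanishing.
by congr (_ - _); rewrite [X in X - _](wandering_decomposition Nf) addrK.
Qed.

(** The e_j are orthonormal and orthogonal to N, so the defect coefficients are inner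
products. *)
Lemma defect_coefs f (g1 : ell2 R n) (d : 'I_m -> C R) : N g1 ->
  bshift (P0 f) = g1 + \sum_j d j *: ee j -> forall j, iprod (P0 f) (fshift (ee j)) = d j.
Proof.
move=> Ng1 bE j; rewrite -iprod_shift bE iprodDl iprod_orthonormal // (iprodC (ee j)) eeN //.
by rewrite conjC0 add0r.
Qed.

Lemma peel_model f (g1 : ell2 R n) (d : 'I_m -> C R) : N f -> N g1 ->
  bshift (P0 f) = g1 + \sum_j d j *: ee j -> peel multipliers functionals f = g1.
Proof.
move=> Nf Ng1 bE; rewrite /peel strip_model //.
apply: (@eq_trans _ _ (bshift (P0 f) - \sum_j d j *: ee j)); last by rewrite bE addrK.
rewrite bshiftD -scaleN1r bshiftZ scaleN1r bshift_sum; congr (_ - _).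
by apply: eq_bigr => j _; rewrite bshiftZ bshift_fshift (defect_coefs Ng1 bE).
Qed.

Lemma proj_vanishing f : vanishing (P0 f).
Proof. exact: orth_proj_in vanishing_closed f. Qed.

Lemma peel_model_in f : N f -> N (peel multipliers functionals f).
Proof. by move=> Nf; have [g1 [d [Ng1 bE]]] := eeD (proj_vanishing f);
  rewrite (peel_model Nf Ng1 bE). Qed.

Lemma strip_model0 f : N f -> strip multipliers functionals f 0%N = 0.
Proof.
move=> Nf; rewrite strip_model // ell2D ell2N ell2_sum big1 ?subr0 => [|j _].
  by have [] := proj_vanishing f.
by rewrite ell2Z fshift0 scaler0.
Qed.

(** Pythagoras twice: f splits along W and the vanishing functions, and S* P0 f along
N and the defect space. *)
Lemma energy_model f : N f ->
  sqnorm f = sqnorm (peel multipliers functionals f) + colsq (readout functionals f).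
Proof.
move=> Nf; have [g1 [d [Ng1 bE]]] := eeD (proj_vanishing f).
rewrite (peel_model Nf Ng1 bE) [in LHS](wandering_decomposition Nf) pythagoras; last first.
  rewrite iprod_sumr big1 // => i _;
    rewrite iprodZr (iprodC (ff i) (P0 f)) ffV ?conjC0 ?mulr0 //; exact: proj_vanishing.
rewrite (sqnorm_orthonormal _ ffO) (sqnorm_bshift (P0 f)) (proj_vanishing f).2 colsq0 add0r bE.
rewrite pythagoras; last first.
  by rewrite iprod_sumr big1 // => j _; rewrite iprodZr (iprodC (ee j) g1) eeN // conjC0 mulr0.
rewrite (sqnorm_orthonormal _ eeO) -addrA; congr (_ + _).
rewrite /colsq big_split_ord /= addrC; congr (_ + _); apply: eq_bigr => i _; rewrite mxE.
  by rewrite functionalsl.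
by rewrite functionalsr iprod_proj_vanishing (defect_coefs Ng1 bE).
Qed.

End Model.

Lemma normsq_head_tail (R : realType) r m (k : vfun R (r + m)) :
  normsq k = normsq (head_part k) + \sum_(j < m) hardy_normsq (entry (tail_part k) j).
Proof.
have hE i : entry (head_part k) i = entry k (lshift m i).
  by apply/funext => z; rewrite /entry /head_part mxE.
have tE j : entry (tail_part k) j = entry k (rshift r j).
  by apply/funext => z; rewrite /entry /tail_part mxE.
rewrite /normsq; under [X in _ = X + _]eq_bigr => i _ do rewrite hE.
by under [X in _ = _ + X]eq_bigr => j _ do rewrite tE; rewrite big_split_ord.
Qed.

Section Representation.
Variables (R : realType) (n m : nat) (M : set (vfun R n)) (cM : closed_subspace M).
Variables (D : set (vfun R n)) (e : 'I_m -> vfun R n).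

Lemma repr_nonvanishingE r (F0 : disc R -> 'M[C R]_(n, r)) (ff : 'I_r -> ell2 R n)
    (ee : 'I_m -> ell2 R n) (k : ell2 R (r + m)) z :
  (forall i, columns F0 i = realize (ff i)) -> (forall j, e j = realize (ee j)) ->
  repr_nonvanishing F0 e (realize k) z =
    \sum_a realize k z a 0 *: realize (multipliers ff ee a) z.
Proof.
move=> Hff Hee; rewrite /repr_nonvanishing mulmx_sum_col big_split_ord; congr (_ + _).
  by apply: eq_bigr => i _; rewrite multipliersl -Hff /columns /head_part mxE.
rewrite /repr_vanishing scaler_sumr; apply: eq_bigr => j _.
by rewrite multipliersr realize_fshift -Hee /tail_part mxE scalerA mulrC -scalerA scalerA.
Qed.

(** Holds for every r; r = 0 covers the subspaces vanishing at 0. *)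
Lemma representation r (F0 : disc R -> 'M[C R]_(n, r)) :
  defect_space M m D -> orthogonal_sets D M -> orthonormal_basis e D ->
  orthonormal_basis (columns F0) (ominus M (M `&` zH2 R n)) ->
  exists K : set (vfun R (r + m)),
    [/\ closed_subspace K, backshift_invariant K,
        M = [set repr_nonvanishing F0 e k | k in K] &
        forall k, K k -> normsq (repr_nonvanishing F0 e k) =
          normsq (head_part k) + \sum_(j < m) hardy_normsq (entry (tail_part k) j)].
Proof.
move=> [DH _ _ MD] oDM oe oF.
have [MH [M0 ML] _] := cM.
have WH : ominus M (M `&` zH2 R n) `<=` H2 R n by move=> F [/MH].
have [ee [eeE eeO]] := orthonormal_coefs oe DH.
have [ff [ffE ffO]] := orthonormal_coefs oF WH.
pose N : set (ell2 R n) := [set a | M (realize a)].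
have cN : closed_sub N := closed_sub_coefs cM.
have ffW0 i : ominus M (M `&` zH2 R n) (realize (ff i)).
  by rewrite -ffE oF.2; exact: span_mem.
have ffN i : N (ff i) by case: (ffW0 i).
have ffV i g : vanishing N g -> iprod (ff i) g = 0.
  move=> [Ng g0]; rewrite -inner_realize; apply: (ffW0 i).2; split => //.
  exact/zH2_realize.
have cV := vanishing_closed cN.
have ffW f : N f -> exists c : 'I_r -> C R, f - orth_proj (vanishing N) f = \sum_i c i *: ff i.
  move=> Nf.
  have : ominus M (M `&` zH2 R n) (realize (f - orth_proj (vanishing N) f)).
    split; first by apply: (closed_subB cN) => //; have [] := orth_proj_in cV f.
    move=> G [MG zG]; have [g Gg] := H2P (MH _ MG); rewrite Gg in MG zG *.
    rewrite inner_realize; apply: (orth_projP cV f).2; split => //; exact/zH2_realize.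
  rewrite oF.2 => -[c fc]; exists c; apply: realize_inj; rewrite fc realize_sum.
  by apply: eq_bigr => i _; rewrite realizeZ ffE.
have eeN j g : N g -> iprod (ee j) g = 0.
  move=> Ng; rewrite -inner_realize; apply: oDM => //; rewrite -eeE oe.2; exact: span_mem.
have eeD g : vanishing N g ->
    exists (g1 : ell2 R n) (d : 'I_m -> C R), N g1 /\ bshift g = g1 + \sum_j d j *: ee j.
  move=> [Ng g0].
  have [|G1 [G2 [MG1 DG2 GE]]] := MD (realize g) Ng; first by rewrite realize_at0.
  have [g1 Gg] := H2P (MH _ MG1); rewrite oe.2 in DG2; have [d dE] := DG2.
  exists g1, d; split; first by rewrite /N /= -Gg.
  apply: realize_inj; rewrite -backshift_realize GE Gg dE realizeD realize_sum; congr (_ + _).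
  by apply: eq_bigr => j _; rewrite realizeZ eeE.
pose E := multipliers ff ee; pose h := functionals N ff ee.
have hN a : N (h a) by exact: functionalsN.
have peelN f : N f -> N (peel E h f) by exact: peel_model_in.
have energy f : N f -> sqnorm f = sqnorm (peel E h f) + colsq (readout h f)
  by exact: energy_model.
have strip0 f : N f -> strip E h f 0%N = 0 by exact: strip_model0.
have reprE f k : is_symbol N E h f k -> repr_nonvanishing F0 e (realize k) = realize f.
  move=> kf; apply/funext => z; rewrite (repr_nonvanishingE k z ffE eeE).
  by rewrite (realize_symbol peelN energy strip0 z kf).
exists (realize @` symbols N E h); split.
- by apply: closed_subspace_image; exact: symbols_closed.
- apply: backshift_invariant_image => k [f kf]; exists (peel E h f).
  exact: is_symbol_peel.
- apply/seteqP; split => [F MF|_ [_ [k [f kf] <-] <-]]; last first.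
    by rewrite (reprE f k kf); case: kf.
  have [f Ff] := H2P (MH _ MF); have Nf : N f by rewrite /N /= -Ff.
  have [k kf] := is_symbol_ex peelN energy Nf.
  by exists (realize k); [exists k => //; exists f|rewrite (reprE f k kf)].
- move=> _ [k [f kf] <-]; rewrite (reprE f k kf) -normsq_head_tail !normsq_realize.
  exact: esym (is_symbol_isometry cN hN peelN energy kf).
Qed.

End Representation.

(** * From a representation to near invariance *)

Section Converse.
Variables (R : realType) (n m : nat) (M : set (vfun R n)) (cM : closed_subspace M).
Variables (D : set (vfun R n)) (e : 'I_m -> vfun R n).
Hypotheses (DH : D `<=` H2 R n) (oDM : orthogonal_sets D M) (oe : orthonormal_basis e D).

Lemma backshift_scale (F G : vfun R n) : H2 R n G -> (forall z, F z = val z *: G z) ->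
  backshift F = G.
Proof.
move=> /H2P[g ->] FG; have -> : F = realize (fshift g) by apply/funext => z;
  rewrite FG realize_fshift.
by rewrite backshift_realize bshift_fshift.
Qed.

(** Splitting k(z) = k(0) + z (S* k)(z) in both parts of the representation. *)
Lemma repr_backshift r (F0 : disc R -> 'M[C R]_(n, r)) (k : ell2 R (r + m)) z :
  repr_nonvanishing F0 e (realize k) z = F0 z *m usubmx (k 0%N) +
  val z *: (repr_nonvanishing F0 e (realize (bshift k)) + \sum_j k 0%N (rshift r j) 0 *: e j) z.
Proof.
rewrite /repr_nonvanishing /head_part /repr_vanishing /tail_part.
rewrite -[((_ : vfun R n) + _) z]/(_ z + _ z) vfun_sumE realize_split.
move: (k 0%N) (realize (bshift k) z) (val z) => u v w.
have -> : usubmx (u + w *: v) = usubmx u + w *: usubmx v.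
  by apply/matrixP => i j; rewrite !mxE.
have -> : \sum_j dsubmx (u + w *: v) j 0 *: e j z =
    \sum_j u (rshift r j) 0 *: e j z + w *: \sum_j dsubmx v j 0 *: e j z.
  rewrite scaler_sumr -big_split /=; apply: eq_bigr => j _.
  by rewrite scalerA -scalerDl; congr (_ *: _); rewrite !mxE.
rewrite mulmxDr -scalemxAr -addrA; congr (_ + _).
by rewrite !scalerDr -addrA [X in _ + X]addrC.
Qed.

Lemma nearly_invariant_of_representation r (F0 : disc R -> 'M[C R]_(n, r))
    (K : set (vfun R (r + m))) :
  has_dim D m -> orthonormal_basis (columns F0) (ominus M (M `&` zH2 R n)) ->
  closed_subspace K -> backshift_invariant K ->
  M = [set repr_nonvanishing F0 e k | k in K] -> nearly_invariant M m.
Proof.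
move=> dimD oF [KH _ _] KB ME; split => //; exists D.
have [MH [M0 ML] _] := cM.
have WH : ominus M (M `&` zH2 R n) `<=` H2 R n by move=> F [/MH].
have [ff [ffE ffO]] := orthonormal_coefs oF WH.
split => //.
  apply/seteqP; split => F.
    by move=> [MF DF]; apply: inner_eq0; [exact: MH|exact: oDM].
  move=> ->; split => //; rewrite oe.2; exists (fun=> 0).
  by rewrite big1 // => j _; rewrite scale0r.
move=> F MF F0z.
have [kf Kk kF] : [set repr_nonvanishing F0 e k | k in K] F by rewrite -ME.
have [k kE] := H2P (KH _ Kk); subst kf.
(* the head of k(0) is the coefficient vector of an element of W vanishing at 0 *)
have k0 : usubmx (k 0%N) = 0.
  pose c i := usubmx (k 0%N) i 0.
  have W0 : \sum_i c i *: columns F0 i = 0.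
    have WW : ominus M (M `&` zH2 R n) (\sum_i c i *: columns F0 i) by rewrite oF.2; exists c.
    apply: (wandering_eval_injective cM WW).
    transitivity (F (disc0 R)) => //.
    rewrite vfun_sumE -kF repr_backshift scale0r addr0 mulmx_sum_col.
    by apply: eq_bigr.
  apply/matrixP => i j; rewrite (ord1 j) [RHS]mxE -/(c i).
  rewrite -(iprod_orthonormal c i ffO).
  have -> : \sum_i c i *: ff i = 0.
    apply: realize_inj; rewrite realize0 realize_sum -[RHS]W0; apply: eq_bigr => l _.
    by rewrite realizeZ ffE.
  by rewrite iprod0l.
exists (repr_nonvanishing F0 e (backshift (realize k))), (\sum_j k 0%N (rshift r j) 0 *: e j).
have MB : M (repr_nonvanishing F0 e (backshift (realize k))).
  by rewrite ME; exists (backshift (realize k)) => //; exact: KB.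
have DB : D (\sum_j k 0%N (rshift r j) 0 *: e j).
  by rewrite oe.2; exists (fun j => k 0%N (rshift r j) 0).
split => //; apply: backshift_scale.
  have [a ->] := H2P (MH _ MB); have [b ->] := H2P (DH DB).
  by rewrite -realizeD; exact: H2_realize.
by move=> z; rewrite -kF repr_backshift k0 mulmx0 add0r backshift_realize.
Qed.

End Converse.

Section EmptyHead.
Variables (R : realType) (n m : nat).

Lemma repr_nonvanishing0 (F0 : disc R -> 'M[C R]_(n, 0)) (e : 'I_m -> vfun R n) (k : vfun R m) :
  repr_nonvanishing F0 e (k : vfun R (0 + m)) = repr_vanishing e k.
Proof.
apply/funext => z; rewrite /repr_nonvanishing /repr_vanishing.
rewrite (_ : F0 z = 0) ?mul0mx ?add0r; last by apply/matrixP => i [].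
congr (_ *: _); apply: eq_bigr => j _; congr (_ *: _).
by rewrite /tail_part mxE; congr (k z _ _); apply: val_inj.
Qed.

Lemma tail_part0 (k : vfun R m) : tail_part (k : vfun R (0 + m)) = k.
Proof.
apply/funext => z; apply/matrixP => j i; rewrite /tail_part mxE.
by congr (k z _ _); apply: val_inj.
Qed.

Lemma orthonormal_basis_empty (F0 : disc R -> 'M[C R]_(n, 0)) :
  orthonormal_basis (columns F0) [set 0].
Proof.
split; first by case.
apply/seteqP; split => F; first by move=> ->; exists (fun=> 0); rewrite big_ord0.
by move=> [c ->]; rewrite big_ord0.
Qed.

End EmptyHead.

Theorem theorem3p4 (R : realType) (n m : nat) (M : set (vfun R n))
    (closedM : closed_subspace M) :
  (forall (D : set (vfun R n)) (e : 'I_m -> vfun R n),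
     defect_space M m D -> orthogonal_sets D M -> orthonormal_basis e D ->
     ((exists F, M F /\ F (disc0 R) != 0) ->
        let W := ominus M (M `&` zH2 R n) in
        exists r : nat, has_dim W r /\
        forall F0 : disc R -> 'M[C R]_(n, r),
          orthonormal_basis (columns F0) W ->
          exists K : set (vfun R (r + m)),
            [/\ closed_subspace K, backshift_invariant K,
                M = [set repr_nonvanishing F0 e k | k in K] &
                forall k, K k ->
                  normsq (repr_nonvanishing F0 e k) =
                    normsq (head_part k) +
                    \sum_(j < m) hardy_normsq (entry (tail_part k) j)])
     /\
     ((forall F, M F -> F (disc0 R) = 0) ->
        exists K : set (vfun R m),
          [/\ closed_subspace K, backshift_invariant K,
              M = [set repr_vanishing e k | k in K] &
              forall k, K k ->
                normsq (repr_vanishing e k) =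
                  \sum_(j < m) hardy_normsq (entry k j)]))
  /\
  (forall (D : set (vfun R n)) (e : 'I_m -> vfun R n),
     D `<=` H2 R n -> has_dim D m -> orthogonal_sets D M ->
     orthonormal_basis e D ->
     (exists (r : nat) (F0 : disc R -> 'M[C R]_(n, r)) (K : set (vfun R (r + m))),
        [/\ orthonormal_basis (columns F0) (ominus M (M `&` zH2 R n)),
            closed_subspace K, backshift_invariant K &
            M = [set repr_nonvanishing F0 e k | k in K]])
     \/
     (exists K : set (vfun R m),
        [/\ closed_subspace K, backshift_invariant K &
            M = [set repr_vanishing e k | k in K]]) ->
     nearly_invariant M m).
Proof.
pose F00 : disc R -> 'M[C R]_(n, 0) := fun=> 0.
split=> [D e dD oDM oe|D e DH dimD oDM oe].
  split=> [_ W|MV].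
    have [r Wr] := wandering_has_dim closedM.
    exists r; split => // F0 oF; exact: (representation closedM dD oDM oe oF).
  have oF : orthonormal_basis (columns F00) (ominus M (M `&` zH2 R n)).
    by rewrite (wandering_vanishing closedM MV); exact: orthonormal_basis_empty.
  have [K [cK KB ME KN]] := representation closedM dD oDM oe oF.
  exists K; split => //.
    by rewrite [LHS]ME; apply/seteqP; split => _ [k Kk <-]; exists k;
      rewrite // repr_nonvanishing0.
  move=> k Kk; rewrite -(repr_nonvanishing0 F00) (KN k Kk) tail_part0.
  by rewrite /normsq big_ord0 add0r.
move=> [[r [F0 [K [oF cK KB ME]]]]|[K [cK KB ME]]].
  exact: (nearly_invariant_of_representation closedM DH oDM oe dimD oF cK KB ME).
have MV F : M F -> F (disc0 R) = 0 by rewrite ME => -[k _ <-]; rewrite /repr_vanishing scale0r.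
have oF : orthonormal_basis (columns F00) (ominus M (M `&` zH2 R n)).
  by rewrite (wandering_vanishing closedM MV); exact: orthonormal_basis_empty.
apply: (@nearly_invariant_of_representation _ _ _ _ closedM _ _ DH oDM oe 0 F00 K dimD oF cK KB).
by rewrite [LHS]ME; apply/seteqP; split => _ [k Kk <-]; exists k; rewrite // repr_nonvanishing0.
Qed.
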